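(* Let $n>1$, $r=2^n$ and $M=38^{2^n}+1$. Let $\pi=-1-\zeta_{19}^2+\zeta_{19}^{15}\in\mathbb{Z}[\zeta_{38}]$ and $\alpha=(\pi/\bar\pi)^{\tau}$, where $\tau=1+3\sigma_{13}+5\sigma_{-15}+7\sigma_{11}+9\sigma_{17}+11\sigma_7+13\sigma_3+15\sigma_{-5}+17\sigma_9$. For $k\ge0$ and $1\leq j\leq9$ define $S_k^{(j)}=f^{(j)}(\alpha_1^{(k)},\ldots,\alpha_9^{(k)})$, where $f^{(j)}$ is the $j$-th elementary symmetric polynomial in $9$ variables, $\alpha_1^{(k)}=\alpha^{38^k}+\bar\alpha^{38^k}$, and $\alpha_i^{(k)}=\sigma_{2i-1}(\alpha_1^{(k)})$ for $2\leq i\leq9$. Suppose that every integer $x$ with $1<x<19^r$ and $x^{18}\equiv1\pmod{19^r}$ does not divide $M$. Then $M$ is prime if and only if one of the following holds: (i) $M$ is congruent modulo $229$ to one of $-48,\ -44,\ 15,\ -4,\ 56,\ -55,\ -45,\ -61,\ 26,\ 49$, and $S_{r-1}^{(1)}\equiv-1$, $S_{r-1}^{(2)}\equiv-8$, $S_{r-1}^{(3)}\equiv7$, $S_{r-1}^{(4)}\equiv21$, $S_{r-1}^{(5)}\equiv-15$, $S_{r-1}^{(6)}\equiv-20$, $S_{r-1}^{(7)}\equiv10$, $S_{r-1}^{(8)}\equiv5$, $S_{r-1}^{(9)}\equiv-1\pmod M$; (ii) $M$ is congruent modulo $229$ to one of $-98,\ 38,\ 92,\ -69,\ 112,\ -35,\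 -77,\ -32$, and $S_{r-1}^{(1)}\equiv1$, $S_{r-1}^{(2)}\equiv-8$, $S_{r-1}^{(3)}\equiv-7$, $S_{r-1}^{(4)}\equiv21$, $S_{r-1}^{(5)}\equiv15$, $S_{r-1}^{(6)}\equiv-20$, $S_{r-1}^{(7)}\equiv-10$, $S_{r-1}^{(8)}\equiv5$, $S_{r-1}^{(9)}\equiv1\pmod M$.
   Context: $\zeta_m=e^{2\pi\sqrt{-1}/m}$ and a bar denotes complex conjugation. For $c$ coprime to $38$, $\sigma_c\in G=\mathrm{Gal}(\mathbb{Q}(\zeta_{38})/\mathbb{Q})$ sends $\zeta_{38}$ to $\zeta_{38}^c$; $1$ denotes $\sigma_1$ in $\mathbb{Z}[G]$. For $\tau=\sum_{\sigma\in G}k_\sigma\sigma\in\mathbb{Z}[G]$ and $\beta\neq0$, $\beta^\tau:=\prod_{\sigma}\sigma(\beta)^{k_\sigma}$. The $S_k^{(j)}$ are rational numbers with denominators prime to $M$; congruences modulo $M$ are understood in the ring of rationals with denominator prime to $M$. *)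

(* Defs.v *)
From mathcomp Require Import all_boot all_order all_algebra all_fingroup all_field.
From mathcomp Require Import mpoly.

Set Implicit Arguments.
Unset Strict Implicit.
Unset Printing Implicit Defensive.

Import Order.TTheory GRing.Theory Num.Theory.
Local Open Scope ring_scope.

(* [m.-root z] is the m-th root of z of least nonnegative argument, so this is
   exp(i pi / 19) = exp(2 i pi / 38). *)
Definition zeta38C : algC := 19.-root (-1).

(* [L] is a copy of the field Q(zeta_38): it embeds into algC by [iota], and it
   is generated over Q by the preimage [zeta] of zeta_38. *)
Definition is_Qzeta38 (L : splittingFieldType rat)
    (iota : {rmorphism L -> algC}) (zeta : L) : Prop :=
  iota zeta = zeta38C /\ <<1; zeta>>%VS = fullv.

(* Since [zeta] generates [L] and [iota] is injective, the two conditions below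
   determine [sigma c], for c prime to 38, and [bar]. *)
Definition is_sigma (L : splittingFieldType rat) (zeta : L)
    (sigma : int -> gal_of {:L}) : Prop :=
  forall c : int, coprimez c 38 -> sigma c zeta = zeta ^ c.

Definition is_conjugation (L : splittingFieldType rat)
    (iota : {rmorphism L -> algC}) (bar : L -> L) : Prop :=
  forall x : L, iota (bar x) = (iota x)^*.

Section GroupRing.
Variable L : splittingFieldType rat.

(* The additive group of Z[G], for G = Gal(L/Q), as functions from G to Z. *)
Local Notation ZG := {ffun gal_of {:L} -> int}.

Definition ofG (s : gal_of {:L}) : ZG := [ffun t => (t == s)%:Z].

Definition ZGpow (b : L) (t : ZG) : L :=
  \prod_(s in 'Gal({:L} / 1)%g) (s b) ^ (t s).

End GroupRing.

Section Sequences.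
Variables (L : splittingFieldType rat) (zeta : L).
Variables (sigma : int -> gal_of {:L}) (bar : L -> L).

Definition zeta19 : L := zeta ^+ 2.

Definition pi229 : L := - 1 - zeta19 ^+ 2 + zeta19 ^+ 15.

Definition tau : {ffun gal_of {:L} -> int} :=
  ofG (sigma 1) + ofG (sigma 13) *+ 3 + ofG (sigma (- 15)) *+ 5
  + ofG (sigma 11) *+ 7 + ofG (sigma 17) *+ 9 + ofG (sigma 7) *+ 11
  + ofG (sigma 3) *+ 13 + ofG (sigma (- 5)) *+ 15 + ofG (sigma 9) *+ 17.

Definition alpha : L := ZGpow (pi229 / bar pi229) tau.

Definition alpha1 (k : nat) : L := alpha ^+ (38 ^ k) + (bar alpha) ^+ (38 ^ k).

(* With i counted from 0, this is the conjugate of index i + 1; for i = 0 it is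
   [alpha1 k], as [sigma 1] is the identity. *)
Definition alphaconj (k : nat) (i : 'I_9) : L :=
  sigma (2 * i + 1)%:Z (alpha1 k).

Definition Sk (k j : nat) : L := (mesym 9 L j).@[alphaconj k].

End Sequences.

Definition den_prime_to (M : nat) (x : rat) : Prop := coprimez (denq x) M.

(* Congruence modulo M in the ring of rationals with denominator prime to M. *)
Definition congr_rat (M : nat) (x y : rat) : Prop :=
  [/\ den_prime_to M x, den_prime_to M y
    & exists2 t : rat, den_prime_to M t & x - y = M%:R * t].

(* The element x of L is a rational number congruent to the integer a. *)
Definition congr_in (L : splittingFieldType rat) (M : nat) (x : L) (a : int)
    : Prop :=
  exists2 q : rat, x = q%:A & congr_rat M q a%:~R.

Definition congr_one_of (m : int) (d : int) (s : seq int) : Prop :=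
  exists2 a : int, a \in s & (m = a %[mod d])%Z.

(* Main.v *)
Require Import Defs.
From mathcomp Require Import all_boot all_order all_algebra all_fingroup all_field.
From mathcomp Require Import mpoly.
From mathcomp Require Import ring.

(* When [M] is prime, the sums [S] tell which 38th root of unity is the power residue
   symbol [alpha ^ ((M - 1) / 38)] modulo a prime above [M]. As [tau] is half of
   Stickelberger's element, [alpha] is the 38th power of a Gauss sum of order 38
   modulo 229, up to a root of unity and a 38th power; and Frobenius multiplies the
   Gauss sum by the inverse of the character of order 38 at [M]. So the symbol is
   determined by the class of [M] modulo 229, which for [n > 1] can only be one of the
   18 listed ones. Conversely, modulo a prime above any prime divisor [l] of [M], the
   congruences make 19 ^ r divide the order of [alpha], whence l ^ 18 = 1 modulo
   19 ^ r; by hypothesis l >= 19 ^ r, and M < (19 ^ r) ^ 2 is prime. *)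

Set Implicit Arguments.
Unset Strict Implicit.
Unset Printing Implicit Defensive.

Import Order.TTheory GRing.Theory Num.Theory.
Local Open Scope ring_scope.

(** * Gauss and Jacobi sums *)

(** No ideals appear: a prime above l is replaced by a field [K] of characteristic l with a
    primitive 38th root of unity [z], and reduction by the relation [specializes] between [L] and
    [K]. The Gauss sum is formed inside such a [K] that also has a root of unity of order 229, so
    that Frobenius is a ring morphism acting on it directly. To serve [L] and every [K] at once,
    identities between conjugates of pi are proved wherever 1 + y + ... + y^18 = 0, by comparing
    integer coefficients. The 38th power of the Gauss sum is factored explicitly: Jacobi sums double
    the exponent of the character along 1, 2, 4, 8, 16, 32, then 32 + 4 = 36 and 36 + 2 = 38 reach
    the trivial character. The first six Jacobi sums are powers of zeta_19 times nine conjugates of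
    pi. A 38th root of unity is a sign times a 19th root of unity. Here the sign is the quadratic
    character of M modulo 229, which separates (i) from (ii), and the 19th root is primitive, so its
    nine sums x^i + x^-i have fixed elementary symmetric functions. *)

Section GaussSums.
Variables (F : finFieldType) (K : comNzRingType).
Implicit Types (chi : F -> K) (psi : F -> K).

Definition multiplicative_char chi :=
  chi 0 = 0 /\ {morph chi : x y / x * y}.

Definition gauss_sum chi psi : K := \sum_x chi x * psi x.

Definition jacobi_sum chi1 chi2 : K := \sum_x chi1 x * chi2 (1 - x).

(* The second term collects the pairs [(x, y)] with [x + y = 0]. *)
Lemma gauss_sumM chi1 chi2 psi :
    multiplicative_char chi1 -> multiplicative_char chi2 ->
    {morph psi : x y / x + y >-> x * y} -> psi 0 = 1 ->
  gauss_sum chi1 psi * gauss_sum chi2 psi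
    = jacobi_sum chi1 chi2 * gauss_sum (fun x => chi1 x * chi2 x) psi
      + chi2 (- 1) * \sum_x chi1 x * chi2 x.
Proof.
move=> [c10 c1M] [c20 c2M] psiD psi0.
rewrite /gauss_sum big_distrlr /=.
transitivity (\sum_x \sum_t chi1 x * chi2 (t - x) * psi t).
  apply: eq_bigr => x _; rewrite (reindex_inj (addrI (- x))) /=.
  apply: eq_bigr => t _; have -> : psi t = psi x * psi (- x + t).
    by rewrite -psiD addrA subrr add0r.
  by rewrite (addrC t) mulrACA -!mulrA.
rewrite exchange_big (bigD1 0) //= addrC; congr (_ + _); last first.
  rewrite mulr_sumr; apply: eq_bigr => x _.
  by rewrite psi0 sub0r -(mulN1r x) c2M; ring.
rewrite mulr_sumr [RHS](bigD1 0) //= c10 !mul0r mulr0 add0r.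
apply: eq_bigr => t t0; rewrite (reindex_inj (mulfI t0)) /= /jacobi_sum mulr_suml.
apply: eq_bigr => x _.
have -> : t - t * x = t * (1 - x) by rewrite mulrBr mulr1.
by rewrite c1M c2M; ring.
Qed.

Lemma sum_multiplicative_char (a : F) chi :
    multiplicative_char chi -> a != 0 -> GRing.rreg (chi a - 1) ->
  \sum_x chi x = 0.
Proof.
move=> [_ cM] a0; apply.
rewrite mul0r mulrC mulrBl mul1r [X in _ - X](reindex_inj (mulfI a0)) mulr_sumr.
by apply/eqP; rewrite subr_eq0; apply/eqP/eq_bigr => x _; rewrite cM.
Qed.

Lemma sum_additive_char (a : F) psi :
    {morph psi : x y / x + y >-> x * y} -> GRing.rreg (psi a - 1) ->
  \sum_x psi x = 0.
Proof.
move=> psiD; apply.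
rewrite mul0r mulrC mulrBl mul1r [X in _ - X](reindex_inj (addrI a)) mulr_sumr.
by apply/eqP; rewrite subr_eq0; apply/eqP/eq_bigr => x _; rewrite psiD.
Qed.

Lemma gauss_sum_trivial chi psi :
    (forall x, chi x = (x != 0)%:R) -> psi 0 = 1 -> \sum_x psi x = 0 ->
  gauss_sum chi psi = - 1.
Proof.
move=> chi1 psi0 psi_sum.
have e : \sum_(x | x != 0) psi x = - 1.
  apply/eqP; rewrite -addr_eq0 addrC -psi0.
  by have := psi_sum; rewrite (bigD1 0) //= => ->.
rewrite -e /gauss_sum [RHS]big_mkcond; apply: eq_bigr => x _ /=.
by rewrite chi1; case: eqP; rewrite ?mul0r ?mul1r.
Qed.

Lemma sum_trivial_char chi :
  (forall x, chi x = (x != 0)%:R) -> \sum_x chi x = #|F|.-1%:R.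
Proof.
move=> chi1; rewrite -(cardC1 (0 : F)) -sumr_const [RHS]big_mkcond.
by apply: eq_bigr => x _; rewrite chi1 !inE; case: (x == 0).
Qed.

End GaussSums.

(** * Products of conjugates of [pi] in [Z[zeta_19]] *)

Section CyclicConvolution.
Variables (R : comNzRingType) (y : R).
Hypothesis y_sum : \sum_(i < 19) y ^+ i = 0.

Lemma expr19 : y ^+ 19 = 1.
Proof.
by apply/eqP; rewrite -subr_eq0 subrX1 y_sum mulr0.
Qed.

Definition ev19 (l : seq int) : R := \sum_(i < 19) (l`_i)%:~R * y ^+ i.

(** Multiplication by [y ^+ k] on coefficient lists; [19 - k %% 19] avoids a truncated
    subtraction. *)
Definition shift19 (k : nat) (l : seq int) : seq int :=
  mkseq (fun i => l`_((i + (19 - k %% 19)) %% 19)) 19.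

Definition add19 (l1 l2 : seq int) : seq int := mkseq (fun i => l1`_i + l2`_i) 19.
Definition opp19 (l : seq int) : seq int := mkseq (fun i => - l`_i) 19.

Lemma ev_shift19 k l : ev19 (shift19 k l) = ev19 l * y ^+ k.
Proof.
rewrite /ev19 mulr_suml (reindex_inj (addIr (inZp k : 'I_19))) /=.
apply: eq_bigr => i _; rewrite nth_mkseq ?ltn_pmod //.
rewrite expr_mod ?expr19 // exprD expr_mod ?expr19 // -mulrA.
congr ((nth _ _ _)%:~R * _); rewrite modnDml -addnA subnKC ?(ltnW (ltn_pmod _ _)) //.
by rewrite modnDr modn_small.
Qed.

Lemma ev_add19 l1 l2 : ev19 (add19 l1 l2) = ev19 l1 + ev19 l2.
Proof.
rewrite /ev19 -big_split /=; apply: eq_bigr => i _.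
by rewrite nth_mkseq // rmorphD mulrDl.
Qed.

Lemma ev_opp19 l : ev19 (opp19 l) = - ev19 l.
Proof.
rewrite /ev19 -sumrN; apply: eq_bigr => i _.
by rewrite nth_mkseq // rmorphN mulNr.
Qed.

Lemma ev19_1 : ev19 [:: 1] = 1.
Proof.
rewrite /ev19 big_ord_recl /= expr0 mulr1 big1 ?addr0 // => i _.
by rewrite nth_nil mul0r.
Qed.

(** Equality modulo 1 + y + ... + y^18, whose integer multiples are the constant lists. *)
Definition eqmod19 (l1 l2 : seq int) : bool :=
  all (fun i => l1`_i - l2`_i == l1`_0 - l2`_0) (iota 0 19).

Lemma ev_eqmod19 l1 l2 : eqmod19 l1 l2 -> ev19 l1 = ev19 l2.
Proof.
move=> /allP e; apply/eqP; rewrite -subr_eq0 -ev_opp19 -ev_add19 /ev19.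
have -> : \sum_(i < 19) ((add19 l1 (opp19 l2))`_i)%:~R * y ^+ i
    = \sum_(i < 19) (l1`_0 - l2`_0)%:~R * y ^+ i.
  apply: eq_bigr => i _; rewrite !nth_mkseq //.
  by have /eqP -> : l1`_i - l2`_i == l1`_0 - l2`_0 by apply: e; rewrite mem_iota /=.
by rewrite -mulr_sumr y_sum mulr0.
Qed.

Definition coefs19 (s : seq (bool * nat)) : seq int :=
  mkseq (fun i => (count (fun p => ~~ p.1 && (p.2 %% 19 == i)%N) s)%:Z
                  - (count (fun p => p.1 && (p.2 %% 19 == i)%N) s)%:Z) 19.

Lemma ev_coefs19 s : ev19 (coefs19 s) = \sum_(p <- s) (- 1) ^+ p.1 * y ^+ p.2.
Proof.
elim: s => [|[b e] s IH].
  by rewrite big_nil /ev19 big1 // => i _; rewrite nth_mkseq // subrr mul0r.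
rewrite big_cons -IH {IH} /ev19.
have -> : y ^+ e = \sum_(i < 19) ((e %% 19 == i)%N)%:R * y ^+ i.
  have e19 : (e %% 19 < 19)%N by rewrite ltn_pmod.
  rewrite (bigD1 (Ordinal e19)) // eqxx mul1r expr_mod ?expr19 //.
  rewrite big1 /= ?addr0 // => i /negPf; rewrite eq_sym -val_eqE /= => ->.
  by rewrite mul0r.
rewrite mulr_sumr -big_split /=; apply: eq_bigr => i _.
rewrite !nth_mkseq //= mulrA -mulrDl; congr (_ * _).
rewrite !PoszD !rmorphB !rmorphD /= !pmulrn; case: b => /=; ring.
Qed.

(** The conjugate of pi under zeta_19 -> zeta_19^c. *)
Definition pi19 (c : nat) : R := - 1 - y ^+ (2 * c) + y ^+ (15 * c).

Definition mul_pi19 (c : nat) (l : seq int) : seq int :=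
  add19 (opp19 (add19 l (shift19 (2 * c) l))) (shift19 (15 * c) l).

Lemma ev_mul_pi19 c l : ev19 (mul_pi19 c l) = ev19 l * pi19 c.
Proof.
by rewrite /mul_pi19 !(ev_add19, ev_opp19, ev_shift19) /pi19; ring.
Qed.

Lemma ev_prod_pi19 H l : ev19 (foldr mul_pi19 l H) = ev19 l * \prod_(c <- H) pi19 c.
Proof.
elim: H => [|c H IH] /=; first by rewrite big_nil mulr1.
by rewrite ev_mul_pi19 IH big_cons; ring.
Qed.

(** Reduces the factorization of a character sum to a check on integer lists that [vm_compute]
    decides. *)
Lemma sum_prod_pi19 s k H :
    eqmod19 (coefs19 s) (shift19 k (foldr mul_pi19 [:: 1] H)) ->
  \sum_(p <- s) (- 1) ^+ p.1 * y ^+ p.2 = y ^+ k * \prod_(c <- H) pi19 c.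
Proof.
move=> /ev_eqmod19; rewrite ev_coefs19 => ->.
by rewrite ev_shift19 ev_prod_pi19 ev19_1 mul1r mulrC.
Qed.

Lemma prod_pi19_all : \prod_(c <- iota 1 18) pi19 c = 229%:R.
Proof.
have := ev_prod_pi19 (iota 1 18) [:: 1]; rewrite ev19_1 mul1r => <-.
rewrite (@ev_eqmod19 _ [:: 229%:Z]); last by vm_compute.
rewrite /ev19 big_ord_recl /= expr0 mulr1 big1 ?addr0 // => i _.
by rewrite nth_nil mul0r.
Qed.

End CyclicConvolution.

(** * Gauss sums modulo 229 *)

(* 73 is a primitive root modulo 229; entry [k] is its discrete logarithm of [k]. *)
Definition dlog_table : seq nat := Eval vm_compute in
  let t := traject (fun k => 73 * k %% 229)%N 1 228 in
  [seq index k t | k <- iota 0 229].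

Definition dlog (k : nat) : nat := nth 0 dlog_table k.

Lemma dlog_mul73 k : (0 < k < 229)%N -> dlog ((73 * k) %% 229) = (dlog k).+1 %[mod 38].
Proof.
move=> hk; apply/eqP; move: k hk.
have /allP h : all (fun k => dlog ((73 * k) %% 229) == (dlog k).+1 %[mod 38]) (iota 1 228).
  by vm_compute.
by move=> k hk; apply: h; rewrite mem_iota.
Qed.

Lemma expn73_dlog k : (0 < k < 229)%N -> 73 ^ dlog k = k %[mod 229].
Proof.
pose t := traject (fun m => 73 * m %% 229)%N 1 228.
have nt i : (i < 228)%N -> nth 1%N t i = iter i (fun m => 73 * m %% 229)%N 1%N.
  by move=> lt; rewrite /t nth_traject.
have /allP h : all (fun k => (dlog k < 228) && (nth 1 t (dlog k) == k))%N (iota 1 228).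
  by vm_compute.
have it m : (iter m (fun m => 73 * m %% 229) 1 = 73 ^ m %[mod 229])%N.
  by elim: m => // m IH; rewrite iterS modn_mod -modnMmr IH modnMmr -expnS.
move=> hk; have /h/andP[lt /eqP] : k \in iota 1 228 by rewrite mem_iota.
by rewrite nt // => e; rewrite -it e.
Qed.

Section Characters229.
Variable K : idomainType.

Definition char229 (z : K) (x : 'F_229) : K :=
  if val x == 0%N then 0 else z ^+ dlog (val x).

Definition add_char229 (u : K) (x : 'F_229) : K := u ^+ val x.

Lemma char229_mul73 z x : z ^+ 38 = 1 ->
  char229 z (73%:R * x) = z * char229 z x.
Proof.
move=> z38; have [->|x0] := eqVneq x 0; first by rewrite mulr0 /char229 /= mulr0.
have xpos : (0 < val x < 229)%N.
  by rewrite (ltn_ord x) lt0n andbT; apply: contra x0 => /eqP e; apply/eqP/val_inj.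
have ex : val (73%:R * x) = ((73 * val x) %% 229)%N.
  by rewrite Zp_nat.
have nz : val (73%:R * x) == 0%N = false.
  apply/negbTE; apply: contra x0 => /eqP e.
  have /eqP : (73%:R * x) = 0 by apply: val_inj.
  by rewrite mulf_eq0 Zp_nat -val_eqE.
rewrite /char229 nz ex; case: (val x =P 0%N) => [e|_]; first by rewrite e in xpos.
by rewrite -exprS -(expr_mod _ z38) (dlog_mul73 xpos) expr_mod.
Qed.

Lemma F229_dlog (x : 'F_229) : x != 0 -> x = 73%:R ^+ dlog (val x).
Proof.
move=> x0; have xpos : (0 < val x < 229)%N.
  by rewrite (ltn_ord x) lt0n andbT; apply: contra x0 => /eqP e; apply/eqP/val_inj.
transitivity ((val x)%:R : 'F_229); first by rewrite natr_Zp.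
by rewrite -natrX; apply: val_inj; rewrite !Zp_nat /= (expn73_dlog xpos).
Qed.

Lemma char229M z : z ^+ 38 = 1 -> multiplicative_char (char229 z).
Proof.
move=> z38; split=> // x y; have [->|x0] := eqVneq x 0.
  by rewrite mul0r /char229 /= mul0r.
rewrite (F229_dlog x0); elim: (dlog _) => [|m IH].
  by rewrite expr0 mul1r {2}/char229 /= mul1r.
move: (73%:R) (fun w => char229_mul73 w z38) IH => g gM IH.
by rewrite exprS -mulrA !gM IH mulrA.
Qed.

Lemma char229_mul z1 z2 x : char229 z1 x * char229 z2 x = char229 (z1 * z2) x.
Proof. by rewrite /char229; case: eqP => _; rewrite ?mul0r // exprMn. Qed.

Lemma char229_gen z : char229 z 73%:R = z.
Proof.
have v : val (73%:R : 'F_229) = 73%N by rewrite Zp_nat.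
by rewrite /char229 v.
Qed.

Lemma add_char229D u : u ^+ 229 = 1 ->
  {morph add_char229 u : x y / x + y >-> x * y}.
Proof. by move=> u1 x y; rewrite /add_char229 -exprD -[RHS](expr_mod _ u1). Qed.

(** [230 - k] represents 1 - k modulo 229; [k] = 0 and [k] = 1 are left out because one of the two
    characters vanishes there. Reduction modulo 38 keeps the exponents small for computation. *)
Definition jacobi_exps (a b : nat) : seq nat :=
  [seq a * (dlog k %% 38) + b * (dlog (230 - k) %% 38) | k <- iota 2 227]%N.

Lemma jacobi_sum229 z a b : z ^+ 38 = 1 ->
  jacobi_sum (char229 (z ^+ a)) (char229 (z ^+ b)) = \sum_(e <- jacobi_exps a b) z ^+ e.
Proof.
move=> z38; have zc c k : z ^+ (c * (dlog k %% 38)) = z ^+ (c * dlog k).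
  by rewrite !(exprM z) expr_mod // exprAC z38 expr1n.
rewrite /jacobi_sum.
pose G k := (if k == 0%N then 0 else z ^+ (a * dlog k)) *
   (if ((230 - k) %% 229 == 0)%N then 0 else z ^+ (b * dlog ((230 - k) %% 229))).
transitivity (\sum_(x : 'F_229) G (val x)).
  apply: eq_bigr => x _; rewrite /G /char229 !exprM; congr (_ * _).
  have -> : val (1 - x) = ((230 - val x) %% 229)%N.
    have hx : (val x < 229)%N := ltn_ord x.
    by rewrite /= modnDmr addnBA // ltnW.
  by [].
rewrite -(big_mkord xpredT G) /= big_map.
rewrite (_ : (Zp_trunc _).+2 = 229%N) // big_ltn // big_ltn // {1 2}/G /= mulr0 !mul0r !add0r.
rewrite /index_iota big_seq [RHS]big_seq; apply: eq_bigr => k; rewrite mem_iota => /andP[k2 k229].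
have lt : (230 - k < 229)%N by apply: leq_ltn_trans (leq_sub2l 230 k2) _.
rewrite /G exprD !zc (modn_small lt).
rewrite subn_eq0 leqNgt (ltn_trans k229) //.
by case: eqP k2 => // ->.
Qed.

End Characters229.

Section GaussSum229.
Variables (K : fieldType) (z u : K).
Hypothesis z_sum : \sum_(i < 19) (z ^+ 2) ^+ i = 0.
Hypothesis z19 : z ^+ 19 = -1.
Hypothesis u229 : u ^+ 229 = 1.
Hypothesis u_neq1 : u != 1.

Let y := z ^+ 2.
Let z38 : z ^+ 38 = 1.
Proof. by rewrite (_ : 38 = 19 * 2)%N // exprM z19 sqrrN expr1n. Qed.
Let zk38 k : (z ^+ k) ^+ 38 = 1.
Proof. by rewrite -exprM mulnC exprM z38 expr1n. Qed.

Definition gauss229 (k : nat) : K := gauss_sum (char229 (z ^+ k)) (add_char229 u).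

Let gen_neq0 : (73%:R : 'F_229) != 0.
Proof. by rewrite Zp_nat -val_eqE. Qed.

Let sum_expsE s : \sum_(e <- s) z ^+ e =
  \sum_(p <- [seq (odd e, 10 * (e %% 19))%N | e <- s]) (- 1) ^+ p.1 * y ^+ p.2.
Proof.
rewrite big_map; apply: eq_bigr => e _ /=.
(* Since z^19 = -1, z = -y^10, whence z^e = (-1)^e y^(10 e). *)
have y10 : y ^+ 10 = - z.
  transitivity (z ^+ (2 * 10)); first by rewrite exprM.
  transitivity (z ^+ (19 + 1)); first by [].
  by rewrite exprD z19 expr1 mulN1r.
have zN19 : (- z) ^+ 19 = 1 by rewrite exprNn z19 -signr_odd mulN1r opprK.
by rewrite exprM y10 (expr_mod _ zN19) (exprNn z) signr_odd mulrA -expr2 sqrr_sign mul1r.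
Qed.

Lemma gauss229M (a b k : nat) (H : seq nat) :
    z ^+ (a + b) != 1 ->
    eqmod19 (coefs19 [seq (odd e, 10 * (e %% 19))%N | e <- jacobi_exps a b])
      (shift19 k (foldr mul_pi19 [:: 1] H)) ->
  gauss229 a * gauss229 b = y ^+ k * \prod_(c <- H) pi19 y c * gauss229 (a + b).
Proof.
move=> zab check.
rewrite /gauss229 (gauss_sumM (char229M (zk38 _)) (char229M (zk38 _))
  (add_char229D u229) (expr0 u)).
rewrite (jacobi_sum229 _ _ z38) sum_expsE (sum_prod_pi19 z_sum check).
have eM x : char229 (z ^+ a) x * char229 (z ^+ b) x = char229 (z ^+ (a + b)) x.
  by rewrite char229_mul exprD.
rewrite (eq_bigr _ (fun x _ => eM x)).
rewrite (sum_multiplicative_char (char229M (zk38 _)) gen_neq0); last first.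
  by rewrite char229_gen; apply/mulIf; rewrite subr_eq0.
rewrite mulr0 addr0; congr (_ * _); apply: eq_bigr => x _; by rewrite eM.
Qed.

(** The two characters are inverse to each other, so their Jacobi sum is -chi(-1) and the product of
    the Gauss sums is 229 chi(-1); here chi(-1) = 1. *)
Lemma gauss229_36_2 : gauss229 36 * gauss229 2 = 229%:R.
Proof.
rewrite /gauss229 (gauss_sumM (char229M (zk38 _)) (char229M (zk38 _))
  (add_char229D u229) (expr0 u)).
rewrite (jacobi_sum229 _ _ z38) sum_expsE -(ev_coefs19 z_sum).
rewrite (@ev_eqmod19 _ _ z_sum _ (opp19 [:: 1])); last by vm_compute.
rewrite ev_opp19 ev19_1.
have eM x : char229 (z ^+ 36) x * char229 (z ^+ 2) x = (x != 0)%:R.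
  by rewrite char229_mul -exprD z38 /char229 expr1n -val_eqE; case: eqP.
have psi_sum : \sum_x add_char229 u x = 0.
  apply: (sum_additive_char (a := 1) (add_char229D u229)).
  by apply/mulIf; rewrite subr_eq0 /add_char229 expr1.
rewrite (gauss_sum_trivial eM (expr0 u) psi_sum) (sum_trivial_char eM).
have -> : char229 (z ^+ 2) (- 1) = 1.
  have v : val (- 1 : 'F_229) = 228%N by [].
  transitivity ((z ^+ 2) ^+ dlog 228); first by rewrite /char229 v.
  have d : (2 * dlog 228)%N = (38 * 6)%N by vm_compute.
  by rewrite -exprM d exprM z38 expr1n.
have -> : #|'F_229|.-1 = 228%N by rewrite (card_Fp (isT : prime 229)).
by rewrite mul1r mulrNN mulr1 (natrD K 1 228).
Qed.

(* The exponents are those of [g_1 ^ 38 = (g_1 ^ 2) ^ 19 = (J(1,1) g_2) ^ 19] etc.; the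
   six products are J(1,1), J(2,2), J(4,4), J(8,8), J(16,16) and J(32,4). *)
Lemma gauss229_38 : 38.-primitive_root z ->
  let P H := \prod_(c <- H) pi19 y c in
  gauss229 1 ^+ 38 =
    (y ^+ 11 * P [:: 2; 5; 6; 8; 10; 12; 15; 16; 18]%N) ^+ 19
    * (y ^+ 2 * P [:: 2; 3; 6; 7; 8; 9; 14; 15; 18]%N) ^+ 9
    * (y ^+ 4 * P [:: 4; 6; 12; 14; 16; 18; 9; 11; 17]%N) ^+ 4
    * (y ^+ 8 * P [:: 8; 12; 5; 9; 13; 17; 18; 3; 15]%N) ^+ 2
    * (y ^+ 16 * P [:: 16; 5; 10; 18; 7; 15; 17; 6; 11]%N)
    * (y ^+ 16 * P [:: 6; 12; 14; 18; 3; 9; 11; 15; 17]%N)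
    * 229%:R.
Proof.
move=> z_prim P.
have step a b k H : ~~ (38 %| a + b)%N ->
    eqmod19 (coefs19 [seq (odd e, 10 * (e %% 19))%N | e <- jacobi_exps a b])
      (shift19 k (foldr mul_pi19 [:: 1] H)) ->
    gauss229 a * gauss229 b = y ^+ k * P H * gauss229 (a + b).
  by move=> ab; apply: gauss229M; rewrite -(prim_order_dvd z_prim).
have e1 : gauss229 1 * gauss229 1 =
    y ^+ 11 * P [:: 2; 5; 6; 8; 10; 12; 15; 16; 18]%N * gauss229 2.
  by apply: (@step 1%N 1%N); [| by vm_compute].
have e2 : gauss229 2 * gauss229 2 =
    y ^+ 2 * P [:: 2; 3; 6; 7; 8; 9; 14; 15; 18]%N * gauss229 4.
  by apply: (@step 2%N 2%N); [| by vm_compute].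
have e4 : gauss229 4 * gauss229 4 =
    y ^+ 4 * P [:: 4; 6; 12; 14; 16; 18; 9; 11; 17]%N * gauss229 8.
  by apply: (@step 4%N 4%N); [| by vm_compute].
have e8 : gauss229 8 * gauss229 8 =
    y ^+ 8 * P [:: 8; 12; 5; 9; 13; 17; 18; 3; 15]%N * gauss229 16.
  by apply: (@step 8%N 8%N); [| by vm_compute].
have e16 : gauss229 16 * gauss229 16 =
    y ^+ 16 * P [:: 16; 5; 10; 18; 7; 15; 17; 6; 11]%N * gauss229 32.
  by apply: (@step 16%N 16%N); [| by vm_compute].
have e36 : gauss229 32 * gauss229 4 =
    y ^+ 16 * P [:: 6; 12; 14; 18; 3; 9; 11; 15; 17]%N * gauss229 36.
  by apply: (@step 32%N 4%N); [| by vm_compute].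
have e38 := gauss229_36_2.
move: (P [:: 2; 5; 6; 8; 10; 12; 15; 16; 18]%N) (P [:: 2; 3; 6; 7; 8; 9; 14; 15; 18]%N)
  (P [:: 4; 6; 12; 14; 16; 18; 9; 11; 17]%N) (P [:: 8; 12; 5; 9; 13; 17; 18; 3; 15]%N)
  (P [:: 16; 5; 10; 18; 7; 15; 17; 6; 11]%N) (P [:: 6; 12; 14; 18; 3; 9; 11; 15; 17]%N)
  e1 e2 e4 e8 e16 e36 => p1 p2 p4 p8 p16 p36.
move: (y ^+ 11 * p1) (y ^+ 2 * p2) (y ^+ 4 * p4) (y ^+ 8 * p8) (y ^+ 16 * p16)
  (y ^+ 16 * p36) => j1 j2 j4 j8 j16 j36 e1 e2 e4 e8 e16 e36.
(* Halving the exponents 38, 19, 9, 4 leaves over one factor g_2 (from 19) and one factor g_4 (from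
   9); they are absorbed by g_32 g_4 = J g_36 and g_36 g_2 = 229. *)
have t8 : gauss229 8 ^+ 4 * gauss229 4 * gauss229 2 = j8 ^+ 2 * j16 * j36 * 229%:R.
  rewrite (_ : gauss229 8 ^+ 4 = (gauss229 8 * gauss229 8) ^+ 2); last first.
    by rewrite -expr2 -exprM.
  rewrite e8 exprMn [gauss229 16 ^+ 2]expr2 e16 -e38.
  by rewrite -[_ * _ * gauss229 4]mulrA -[_ * gauss229 32 * _]mulrA e36 !mulrA.
have t4 : gauss229 4 ^+ 9 * gauss229 2 = j4 ^+ 4 * (j8 ^+ 2 * j16 * j36 * 229%:R).
  rewrite -t8 (_ : gauss229 4 ^+ 9 = (gauss229 4 * gauss229 4) ^+ 4 * gauss229 4); last first.
    by rewrite -expr2 -exprM -exprSr.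
  by rewrite e4 exprMn !mulrA.
rewrite (_ : gauss229 1 ^+ 38 = (gauss229 1 * gauss229 1) ^+ 19); last first.
  by rewrite -expr2 -exprM.
rewrite e1 exprMn (_ : gauss229 2 ^+ 19 = (gauss229 2 * gauss229 2) ^+ 9 * gauss229 2); last first.
  by rewrite -expr2 -exprM -exprSr.
by rewrite e2 exprMn -[_ * _ * gauss229 2]mulrA t4 !mulrA.
Qed.

End GaussSum229.

(* The entries [(i, j, k)] satisfy [i * k = 1] and [j = - i] modulo 19, for [k]
   odd below 19; so this is [alpha] as a function of [zeta_19 = y]. *)
Definition alpha_exps : seq (nat * nat * nat) :=
  [:: (1, 18, 1); (13, 6, 3); (4, 15, 5); (11, 8, 7); (17, 2, 9);
      (7, 12, 11); (3, 16, 13); (14, 5, 15); (9, 10, 17)]%N.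

Lemma alpha_exps_range t : t \in alpha_exps -> (0 < t.1.1 < 19)%N && (0 < t.1.2 < 19)%N.
Proof. by move: t; apply/allP. Qed.

Definition alpha19 (K : fieldType) (y : K) : K :=
  \prod_(t <- alpha_exps) (pi19 y t.1.1 / pi19 y t.1.2) ^+ t.2.

Lemma root38_sqrt (R : idomainType) (z : R) :
  38.-primitive_root z -> z ^+ 19 = -1.
Proof.
move=> z_prim; have := prim_expr_order z_prim; rewrite (exprM _ 19 2) => /eqP.
by rewrite sqrf_eq1 -(prim_order_dvd z_prim) /= => /eqP.
Qed.

Lemma prim_root_neq0 (K : fieldType) (m : nat) (x : K) : m.-primitive_root x -> x != 0.
Proof.
move=> x_prim; apply/eqP => x0; have /eqP := prim_expr_order x_prim.
by rewrite x0 expr0n gtn_eqF ?(prim_order_gt0 x_prim) // eq_sym oner_eq0.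
Qed.

(** * The power residue symbol of alpha in characteristic M *)

Section Residue.
Variables (K : fieldType) (z : K).
Hypothesis z_sum : \sum_(i < 19) (z ^+ 2) ^+ i = 0.
Hypothesis z_prim : 38.-primitive_root z.
Hypothesis nz229 : 229%:R != 0 :> K.

Let y := z ^+ 2.

Lemma pi19_modn c : pi19 y (c %% 19) = pi19 y c.
Proof.
have y19 := expr19 z_sum.
by rewrite /pi19 -(expr_mod _ y19) modnMmr (expr_mod _ y19)
  -[y ^+ (15 * _)](expr_mod _ y19) modnMmr (expr_mod _ y19).
Qed.

Lemma pi19_neq0 c : (0 < c < 19)%N -> pi19 y c != 0.
Proof.
move=> hc; apply: contra nz229 => /eqP c0; rewrite -(prod_pi19_all z_sum).
by rewrite (big_rem c) ?mem_iota //= c0 mul0r.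
Qed.

(** The product of Jacobi sums contains pi_i to the power k and its complex conjugate pi_j to the
    power 38 - k, for (i, j, k) in [alpha_exps]; taking out pi_j^38 leaves (pi_i / pi_j)^k. The
    power of y is 291 = 19*11 + 9*2 + 4*4 + 2*8 + 16 + 16. *)
Lemma gauss229_alpha u : u ^+ 229 = 1 -> u != 1 ->
  gauss229 z u 1 ^+ 38 = y ^+ 291 * alpha19 y
    * (\prod_(t <- alpha_exps) pi19 y t.1.2) ^+ 38.
Proof.
move=> u229 u1.
rewrite (gauss229_38 z_sum (root38_sqrt z_prim) u229 u1 z_prim) -(prod_pi19_all z_sum).
rewrite /alpha19 /alpha_exps /= !big_cons !big_nil /= -/y.
have nz c : (0 < c < 19)%N -> pi19 y c != 0 by exact: pi19_neq0.
have n1 := nz 1%N isT; have n2 := nz 2%N isT; have n3 := nz 3%N isT.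
have n4 := nz 4%N isT; have n5 := nz 5%N isT; have n6 := nz 6%N isT.
have n7 := nz 7%N isT; have n8 := nz 8%N isT; have n9 := nz 9%N isT.
have n10 := nz 10%N isT; have n11 := nz 11%N isT; have n12 := nz 12%N isT.
have n13 := nz 13%N isT; have n14 := nz 14%N isT; have n15 := nz 15%N isT.
have n16 := nz 16%N isT; have n17 := nz 17%N isT; have n18 := nz 18%N isT.
(* With 229 rewritten as the product of all conjugates, the identity holds for independent
   variables. *)
move: y (pi19 y 1) (pi19 y 2) (pi19 y 3) (pi19 y 4) (pi19 y 5) (pi19 y 6) (pi19 y 7)
  (pi19 y 8) (pi19 y 9) (pi19 y 10) (pi19 y 11) (pi19 y 12) (pi19 y 13) (pi19 y 14)
  (pi19 y 15) (pi19 y 16) (pi19 y 17) (pi19 y 18) n1 n2 n3 n4 n5 n6 n7 n8 n9 n10 n11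
  n12 n13 n14 n15 n16 n17 n18 => y' p1 p2 p3 p4 p5 p6 p7 p8 p9 p10 p11 p12 p13 p14
  p15 p16 p17 p18 n1 n2 n3 n4 n5 n6 n7 n8 n9 n10 n11 n12 n13 n14 n15 n16 n17 n18.
field; rewrite ?n2 ?n5 ?n6 ?n8 ?n10 ?n12 ?n15 ?n16 ?n18 //.
Qed.

Lemma alpha19_neq0 : alpha19 y != 0.
Proof.
rewrite prodf_seq_neq0; apply/allP => t /alpha_exps_range/andP[t1 t2].
by rewrite /= expf_neq0 // mulf_neq0 ?invr_eq0 ?pi19_neq0.
Qed.

(** Frobenius x -> x^M fixes z, as 38 divides M - 1, and sends u to u^M, so it divides the Gauss sum
    g by chi(M). Hence chi(M) g^(M-1) = 1, and M - 1 = 38 * 38^(r-1) lets g^38 enter. *)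
Lemma alpha19_residue (r M : nat) (u : K) :
    u ^+ 229 = 1 -> u != 1 -> (1 < r)%N -> M = (38 ^ r).+1 -> M \in [pchar K] ->
    ~~ (229 %| M)%N ->
  z ^+ dlog (M %% 229) * alpha19 y ^+ (38 ^ r.-1) = 1.
Proof.
move=> u229 u1 r1 eM pM M229.
have z38 := prim_expr_order z_prim.
have dM : (38 %| 38 ^ r)%N by rewrite dvdn_exp // ltnW.
have zM : z ^+ M = z by rewrite eM exprS -(divnK dM) mulnC exprM z38 expr1n mulr1.
have yM1 : y ^+ M = y by rewrite /y exprAC zM.
have yM k : (y ^+ k) ^+ M = y ^+ k by rewrite exprAC yM1.
have piM c : pi19 y c ^+ M = pi19 y c.
  rewrite -(pFrobenius_autE pM) /pi19 rmorphD rmorphB rmorphN rmorph1 /=.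
  by rewrite !pFrobenius_autE !yM.
have M0 : (M%:R : 'F_229) != 0 by rewrite -(dvdn_pcharf (pchar_Fp (isT : prime 229))).
have mc := @char229M K z z38.
set g := gauss229 z u 1.
have gM : g ^+ M = \sum_x char229 z x * add_char229 u (M%:R * x).
  rewrite -(pFrobenius_autE pM) rmorph_sum /=; apply: eq_bigr => x _.
  rewrite pFrobenius_autE exprMn expr1; congr (_ * _).
    by rewrite /char229; case: eqP => _; rewrite ?expr0n ?eM // -eM exprAC zM.
  have vM : val (M%:R * x) = ((M * val x) %% 229)%N by rewrite Zp_nat /= modnMml.
  by rewrite /add_char229 -exprM vM (expr_mod _ u229) mulnC.
have gMz : char229 z M%:R * g ^+ M = g.
  rewrite gM mulr_sumr [RHS](reindex_inj (mulfI M0)) /=.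
  by apply: eq_bigr => x _; rewrite mulrA -mc.2 expr1.
have eE := gauss229_alpha u229 u1; rewrite -/g in eE.
have E0 : \prod_(t <- alpha_exps) pi19 y t.1.2 != 0.
  rewrite prodf_seq_neq0; apply/allP => t /alpha_exps_range/andP[_ t2].
  exact: pi19_neq0.
have A0 := alpha19_neq0.
have EM : (\prod_(t <- alpha_exps) pi19 y t.1.2) ^+ M
    = \prod_(t <- alpha_exps) pi19 y t.1.2.
  by rewrite -prodrXl; apply: eq_bigr => t _; apply: piM.
move: (\prod_(t <- _) _) eE E0 EM => E eE E0 EM.
have z0 : z != 0 := prim_root_neq0 z_prim.
have g0 : g != 0.
  have : g ^+ 38 != 0.
    by rewrite eE (mulf_neq0 (mulf_neq0 _ A0)) // expf_neq0 // expf_neq0.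
  by rewrite expf_eq0.
have E1 : E ^+ (38 ^ r) = 1.
  by apply: (mulfI E0); rewrite -exprS -eM EM mulr1.
have g1 : char229 z M%:R * g ^+ (38 ^ r) = 1.
  by apply: (mulIf g0); rewrite -mulrA -exprSr -eM gMz mul1r.
have e38 : (38 ^ r = 38 * 38 ^ r.-1)%N by rewrite -expnS prednK // ltnW.
have y1 : y ^+ (38 ^ r.-1) = 1.
  have d : (38 %| 38 ^ r.-1)%N by rewrite dvdn_exp // -ltnS prednK // ltnW.
  by rewrite /y exprAC -(divnK d) mulnC exprM z38 expr1n expr1n.
(* Of the three factors of g^38 only alpha survives: y^38 = 1, and E^(M-1) = 1 because Frobenius
   fixes E. *)
have gE : g ^+ (38 ^ r) = alpha19 y ^+ (38 ^ r.-1).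
  rewrite [in LHS]e38 (exprM g 38) eE 2!exprMn (exprAC y 291) y1 expr1n mul1r.
  by rewrite -(exprM E) -e38 E1 mulr1.
rewrite -gE -[RHS]g1; congr (_ * _).
have vM : val (M%:R : 'F_229) = (M %% 229)%N by rewrite Zp_nat.
by rewrite /char229 vM -/(dvdn 229 M) (negPf M229).
Qed.
End Residue.

(** * Specialization of [Z[zeta_38, 1/229]] *)

Lemma root38_sum (K : fieldType) (z : K) : 38.-primitive_root z ->
  \sum_(i < 19) (z ^+ 2) ^+ i = 0.
Proof.
move=> z_prim; have z2 : z ^+ 2 - 1 != 0.
  by rewrite subr_eq0 -(prim_order_dvd z_prim).
apply: (mulfI z2); rewrite mulr0 -subrX1 -exprM.
by rewrite (prim_expr_order z_prim) subrr.
Qed.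

Lemma zeta38C_prim : 38.-primitive_root zeta38C.
Proof.
have z19 : zeta38C ^+ 19 = -1 by rewrite rootCK.
have z38 : zeta38C ^+ 38 = 1 by rewrite (exprM _ 19 2) z19 sqrrN expr1n.
have [m m_prim dm] := prim_order_exists (isT : (0 < 38)%N) z38.
have : m \in divisors 38 by rewrite -dvdn_divisors.
rewrite (_ : divisors 38 = [:: 1; 2; 19; 38]%N); last by vm_compute.
have odd_m : ~~ (m %| 19)%N.
  by rewrite (prim_order_dvd m_prim) z19 eq_sym -addr_eq0 -(natrD _ 1 1) pnatr_eq0.
rewrite !inE => /or4P[] /eqP m_eq; rewrite m_eq in m_prim odd_m => //.
have /eqP := prim_expr_order m_prim.
rewrite sqrf_eq1 => /orP[/eqP e|/eqP e].
  by move/eqP: z19; rewrite e expr1n -addr_eq0 -(natrD _ 1 1) pnatr_eq0.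
(* Order 2 would make the principal root equal to -1, but a principal root is never negative. *)
have := rootC_lt0 (-1 : algC) (isT : (1 < 19)%N).
by rewrite -[_.-root _]/zeta38C e ltrN10.
Qed.

(** The 38th cyclotomic polynomial, as Phi_19(-X). *)
Definition alt19 : {poly int} := \poly_(i < 19) (- 1) ^+ i.

Lemma size_alt19 : size alt19 = 19%N.
Proof. by rewrite size_poly_eq. Qed.

Lemma alt19_monic : alt19 \is monic.
Proof. by rewrite monicE lead_coef_poly. Qed.

Lemma alt19_root (R : idomainType) (z : R) :
  38.-primitive_root z -> (map_poly intr alt19).[z] = 0.
Proof.
move=> z_prim.
have z19 : (- z) ^+ 19 = 1.
  by rewrite exprNn (root38_sqrt z_prim) -signr_odd mulN1r opprK.
have nz : - z - 1 != 0.
  rewrite -opprD oppr_eq0; apply/eqP => e; have z1 : z = -1 by apply/eqP; rewrite -addr_eq0 e.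
  by have := prim_order_dvd z_prim 2; rewrite z1 sqrrN expr1n eqxx.
apply: (mulfI nz); rewrite mulr0 (@horner_coef_wide _ 19); last first.
  by rewrite (leq_trans (size_poly _ _)) // size_alt19.
transitivity ((- z) ^+ 19 - 1); last by rewrite z19 subrr.
rewrite subrX1; congr (_ * _).
apply: eq_bigr => i _; rewrite coef_map coef_poly ltn_ord /=.
by rewrite rmorphXn rmorphN1 (exprNn z).
Qed.

(** Division by the monic [alt19] stays over the integers, and a remainder of degree below 18, the
    degree of the minimal polynomial of [zc], vanishes at [zc] only if it is zero. *)
Lemma int_poly_vanish (zc : algC) (p : {poly int}) :
    38.-primitive_root zc -> (map_poly intr p).[zc] = 0 ->
  exists q, p = q * alt19.
Proof.
move=> zc_prim p0; exists (Pdiv.Ring.rdivp p alt19).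
have {1}-> := Pdiv.RingMonic.rdivp_eq alt19_monic p.
set r := Pdiv.Ring.rmodp _ _; suff -> : r = 0 by rewrite addr0.
have size_r : (size r < 19)%N.
  rewrite -size_alt19; apply: Pdiv.Ring.ltn_rmodpN0; apply: monic_neq0; exact: alt19_monic.
have r0 : (map_poly intr r).[zc] = 0 :> algC.
  move: p0; have {1}-> := Pdiv.RingMonic.rdivp_eq alt19_monic p.
  rewrite rmorphD rmorphM hornerD hornerM /= (alt19_root zc_prim) mulr0 add0r //.
have [m [m_eq m_monic m_dvd]] := minCpolyP zc.
have size_m : size m = 19%N.
  rewrite -(size_map_poly (ratr : {rmorphism rat -> algC})) /= -m_eq.
  by rewrite (minCpoly_cyclotomic zc_prim) size_cyclotomic.
pose rQ : {poly rat} := map_poly intr r.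
have : m %| rQ.
  rewrite -m_dvd /root -map_poly_comp.
  rewrite (eq_map_poly (g := intr)) ?r0 // => x /=; by rewrite ratr_int.
move=> /dvdp_leq; rewrite size_m => h.
have rQ0 : rQ = 0.
  apply/eqP/negPn/negP => /h; rewrite leqNgt size_map_inj_poly ?size_r //.
  exact: intr_inj.
apply/polyP => i; have := congr1 (fun s : {poly rat} => s`_i) rQ0.
by rewrite coef_map coef0 /= => /eqP; rewrite intr_eq0 => /eqP ->; rewrite coef0.
Qed.

(** The reason for inverting 229: it makes the denominators of alpha accessible to integer
    polynomials. *)
Lemma pi19V (F : fieldType) (x : F) c :
    38.-primitive_root x -> 229%:R != 0 :> F -> (0 < c < 19)%N ->
  (pi19 (x ^+ 2) c)^-1 = (\prod_(d <- rem c (iota 1 18)) pi19 (x ^+ 2) d) / 229%:R.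
Proof.
move=> x_prim nz hc; have x_sum := root38_sum x_prim.
have pc0 := pi19_neq0 x_sum nz hc; apply: (mulfI pc0); apply: (mulIf nz).
rewrite divff // mul1r -mulrA mulfVK // -(prod_pi19_all x_sum).
by rewrite (big_rem c) // mem_iota.
Qed.

Lemma natr_expD (R : comNzRingType) (b m n : nat) (x y : R) :
  b%:R ^+ (m + n) * (x + y) = (b%:R ^+ m * x) *+ (b ^ n) + (b%:R ^+ n * y) *+ (b ^ m).
Proof.
rewrite -[(_ * x) *+ _]mulr_natl -[(_ * y) *+ _]mulr_natl !natrX exprD.
by move: (b%:R ^+ m) (b%:R ^+ n) => c d; ring.
Qed.

Section Specialization.
Variables (L : splittingFieldType rat) (iota : {rmorphism L -> algC}) (zeta : L).
Hypothesis iota_zeta : iota zeta = zeta38C.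
Variables (K : fieldType) (z : K).
Hypothesis z_prim : 38.-primitive_root z.
Hypothesis nz229 : 229%:R != 0 :> K.

(* The graph of the ring morphism from Z[zeta, 1/229] to [K] that maps [zeta] to [z]. *)
Definition specializes (x : L) (a : K) : Prop :=
  exists N (p : {poly int}),
    229%:R ^+ N * x = (map_poly intr p).[zeta] /\
    229%:R ^+ N * a = (map_poly intr p).[z].

Lemma zeta_prim : 38.-primitive_root zeta.
Proof. by rewrite -(fmorph_primitive_root iota) iota_zeta zeta38C_prim. Qed.

(** With additivity this makes the relation single-valued, so that equations in [L] pass to [K]. *)
Lemma specializes0 a : specializes 0 a -> a = 0.
Proof.
move=> [N [p [px pa]]]; have : (map_poly intr p).[zeta38C] = 0 :> algC.
  have := congr1 iota px; rewrite mulr0 rmorph0 -horner_map /= iota_zeta => {1}->.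
  congr (_.[_]); rewrite -map_poly_comp; apply: eq_map_poly => m /=.
  by rewrite rmorph_int.
move=> /(int_poly_vanish zeta38C_prim)[q p_eq]; move: pa.
rewrite p_eq rmorphM hornerM /= (alt19_root z_prim) mulr0 => /eqP.
by rewrite mulf_eq0 expf_eq0 (negPf nz229) andbF => /eqP.
Qed.

Lemma specializes_horner (p : {poly int}) :
  specializes (map_poly intr p).[zeta] (map_poly intr p).[z].
Proof. by exists 0%N, p; rewrite !expr0 !mul1r. Qed.

Lemma specializes_int (m : int) : specializes m%:~R m%:~R.
Proof. by have := specializes_horner m%:P; rewrite !map_polyC !hornerC. Qed.

Lemma specializesD x y a b :
  specializes x a -> specializes y b -> specializes (x + y) (a + b).
Proof.
move=> [N [p [px pa]]] [N' [q [qy qb]]].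
exists (N + N')%N, (p *+ (229 ^ N') + q *+ (229 ^ N)).
rewrite rmorphD [in X in _ /\ X]rmorphD /= !rmorphMn /= !hornerD !hornerMn -px -pa -qy -qb.
by split; rewrite natr_expD.
Qed.

Lemma specializesM x y a b :
  specializes x a -> specializes y b -> specializes (x * y) (a * b).
Proof.
move=> [N [p [px pa]]] [N' [q [qy qb]]]; exists (N + N')%N, (p * q).
rewrite rmorphM [in X in _ /\ X]rmorphM /= !hornerM -px -pa -qy -qb !exprD.
by split; rewrite mulrACA.
Qed.

Lemma specializesX n x a : specializes x a -> specializes (x ^+ n) (a ^+ n).
Proof.
move=> sxa; elim: n => [|n IH]; first exact: (specializes_int 1).
by rewrite !exprS; apply: specializesM.
Qed.

Lemma specializes_sum (I : Type) (s : seq I) (P : pred I) (x : I -> L) (a : I -> K) :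
    (forall i, P i -> specializes (x i) (a i)) ->
  specializes (\sum_(i <- s | P i) x i) (\sum_(i <- s | P i) a i).
Proof.
by move=> sxa; apply: (big_ind2 specializes) => //;
  [apply: (specializes_int 0)|by move=> *; exact: specializesD].
Qed.

Lemma specializes_prod (I : Type) (s : seq I) (P : pred I) (x : I -> L) (a : I -> K) :
    (forall i, P i -> specializes (x i) (a i)) ->
  specializes (\prod_(i <- s | P i) x i) (\prod_(i <- s | P i) a i).
Proof.
by move=> sxa; apply: (big_ind2 specializes) => //;
  [apply: (specializes_int 1)|by move=> *; exact: specializesM].
Qed.

Lemma specializes_div229 x a : specializes x a -> specializes (x / 229%:R) (a / 229%:R).
Proof.
move=> [N [p [px pa]]]; exists N.+1, p; rewrite -px -pa !exprSr.
have nzL : 229%:R != 0 :> L by rewrite -(fmorph_eq0 iota) rmorph_nat pnatr_eq0.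
by split; rewrite mulrAC -mulrA mulfVK.
Qed.

Lemma specializes_mesym n k (v : 'I_n -> L) (w : 'I_n -> K) :
    (forall i, specializes (v i) (w i)) ->
  specializes (mesym n L k).@[v] (mesym n K k).@[w].
Proof.
move=> svw; rewrite !mesymE !rmorph_sum /=; apply: specializes_sum => h _.
by rewrite !mevalX; apply: specializes_prod => i _; apply: specializesX.
Qed.

Lemma specializes_pi19 e c :
  specializes (pi19 (zeta ^+ e) c) (pi19 (z ^+ e) c).
Proof.
have := specializes_horner (- 1 - 'X^(e * (2 * c)) + 'X^(e * (15 * c))).
rewrite /pi19 -!exprM !(rmorphD, rmorphN, rmorph1, map_polyXn) /=
  !(hornerD, hornerN, hornerXn, hornerC).
by rewrite !map_polyXn !hornerXn.
Qed.

Lemma nz229_L : 229%:R != 0 :> L.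
Proof. by rewrite -(fmorph_eq0 iota) rmorph_nat pnatr_eq0. Qed.

Lemma specializes_alpha19 k : coprime k 38 ->
  specializes (alpha19 ((zeta ^+ k) ^+ 2)) (alpha19 ((z ^+ k) ^+ 2)).
Proof.
move=> k38.
have zk : 38.-primitive_root (z ^+ k) by rewrite prim_root_exp_coprime.
have Zk : 38.-primitive_root (zeta ^+ k) by rewrite prim_root_exp_coprime // zeta_prim.
have spi c : specializes (pi19 ((zeta ^+ k) ^+ 2) c) (pi19 ((z ^+ k) ^+ 2) c).
  by rewrite -!exprM; apply: specializes_pi19.
rewrite /alpha19 [X in specializes X]big_seq [X in specializes _ X]big_seq.
apply: specializes_prod => t t_in; apply: specializesX; apply: specializesM => //.
have hc : (0 < t.1.2 < 19)%N by move: t t_in; apply/allP.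
rewrite (pi19V Zk nz229_L hc) (pi19V zk nz229 hc).
by apply: specializes_div229; apply: specializes_prod.
Qed.

(** Clearing the denominator of [t] gives an equation between elements that specialize; that
    denominator is prime to [M], hence nonzero in [K]. *)
Lemma congr_rat_specializes (l M : nat) (q : rat) (c : int) (b : K) :
    l \in [pchar K] -> (l %| M)%N -> congr_rat M q c%:~R ->
    specializes (q%:A) b ->
  b = c%:~R.
Proof.
move=> lK lM [_ _ [t t_den qc]] sqb; pose d := denq t.
have qt : d%:~R * (q - c%:~R) = M%:R * (numq t)%:~R 
  by rewrite qc numqE mulrCA [d%:~R * t]mulrC.
have dt : d%:~R * (q%:A - c%:~R) = (M%:Z * numq t)%:~R :> L.
  have := congr1 (in_alg L) qt.
  by rewrite !rmorphM rmorphB !rmorph_int rmorph_nat.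
have MK : M%:R = 0 :> K by apply/eqP; rewrite -(dvdn_pcharf lK).
have := specializesD (specializesM (specializes_int d)
  (specializesD sqb (specializes_int (- c)))) (specializes_int (- (M%:Z * numq t))).
rewrite !rmorphN dt subrr => /specializes0.
rewrite rmorphM /= -pmulrn MK mul0r subr0 => /eqP; rewrite mulf_eq0 subr_eq0.
move=> /orP[d0|/eqP //]; have : (l %| `|d|)%N.
  by rewrite (dvdn_pcharf lK) -[_ == _]/(`|d|%:R == 0 :> K) pmulrn absz_denq.
move=> ld; have : coprime `|d| M by [].
move=> /(coprime_dvdl ld) /(coprime_dvdr lM).
by rewrite /coprime gcdnn => /eqP l1; have := pcharf_prime lK; rewrite l1.
Qed.

Lemma den_prime_to_frac (M m : nat) (x : rat) (k : int) :
  coprime m M -> m%:R * x = k%:~R -> den_prime_to M x.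
Proof.
move=> mM e; have : (denq x %| m%:Z)%Z.
  have e2 : m%:Z * numq x = k * denq x.
    apply: (intr_inj (R := rat)); rewrite !rmorphM /= numqE mulrA -pmulrn e.
    by [].
  rewrite -(Gauss_dvdzl _ (_ : coprimez (denq x) (numq x))); last first.
    by rewrite coprimez_sym; exact: coprime_num_den.
  by rewrite e2 dvdz_mull.
by move=> /(@coprime_dvdl _ m M); apply.
Qed.

(** Some 229^N (q - c) is rational and a polynomial in zeta, hence an integer; it specializes to 0,
    so M divides it, and 229 is prime to M. *)
Lemma specializes_congr_rat (M : nat) (q : rat) (c : int) :
    prime M -> M \in [pchar K] -> specializes (q%:A) (c%:~R) ->
  congr_rat M q c%:~R.
Proof.
move=> M_prime MK sqc.
have M229 : coprime M 229.
  by rewrite prime_coprime // (dvdn_pcharf MK).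
have [N [p [px pa]]] := specializesD sqc (specializes_int (- c)).
rewrite rmorphN subrr mulr0 in pa.
have e1 : (map_poly intr p).[zeta] = (229%:R ^+ N * (q - c%:~R))%:A.
  by rewrite -px rmorphN -[RHS]/(in_alg L _) rmorphM rmorphXn rmorph_nat rmorphB rmorph_int.
have [m em] : exists m : int, 229%:R ^+ N * (q - c%:~R) = m%:~R.
  have aint : ratr (229%:R ^+ N * (q - c%:~R)) \in Aint.
    have -> : ratr (229%:R ^+ N * (q - c%:~R)) = (map_poly intr p).[zeta38C] :> algC.
      rewrite -(fmorph_eq_rat (iota \o in_alg L)) /= -e1 -horner_map /= iota_zeta.
      by congr (_.[_]); rewrite -map_poly_comp; apply: eq_map_poly => k /=; rewrite rmorph_int.
    rewrite rpred_horner ?(Aint_prim_root zeta38C_prim) //.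
    by apply/polyOverP => i; rewrite coef_map rpred_int.
  have /intrP[m em] := Cint_rat_Aint (Crat_rat _) aint.
  by exists m; apply: (fmorph_inj (ratr : {rmorphism rat -> algC})); rewrite /= em ratr_int.
have m0 : m%:~R = 0 :> K.
  have : specializes 0 (- m%:~R).
    exists 0%N, (p - m%:P); rewrite !expr0 !mul1r !rmorphB /= !hornerD !hornerN.
    rewrite !map_polyC !hornerC e1 em -pa sub0r; split=> //.
    by rewrite -[_%:A]/(in_alg L _) rmorph_int subrr.
  by move=> /specializes0 /eqP; rewrite oppr_eq0 => /eqP.
have [m' em'] : exists m', m = M%:Z * m'.
  have /dvdzP[m' ->] : (M %| m)%Z by rewrite (dvdz_pcharf MK) m0.
  by exists m'; rewrite mulrC.
have n229 : (229 ^ N)%:R != 0 :> rat by rewrite pnatr_eq0 expn_eq0.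
have c229 : coprime (229 ^ N) M by rewrite coprimeXl // coprime_sym.
split.
- apply: (den_prime_to_frac c229 (k := m + (229 ^ N)%:Z * c)).
  by rewrite rmorphD rmorphM /= -pmulrn -em natrX mulrBr subrK.
- by rewrite /den_prime_to denq_int coprimezE /= coprime1n.
exists (m'%:~R / (229 ^ N)%:R).
  by apply: (den_prime_to_frac c229 (k := m')); rewrite mulrC mulfVK.
apply: (mulfI n229); rewrite mulrCA [_ * (_ / _)]mulrC mulfVK // natrX em em'.
by rewrite rmorphM /= -pmulrn.
Qed.
End Specialization.

(** * Elementary symmetric functions *)

(* The elementary symmetric functions of the nine [x ^+ i + x ^- i], for [x] a
   primitive 19th root of unity, and the polynomial with these nine roots. *)
Definition esym19 : seq int := [:: 1; -1; -8; 7; 21; -15; -20; 10; 5; -1].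

Definition psi19 : {poly int} := Poly [:: 1; 5; -10; -20; 15; 21; -7; -8; 1; 1].

Lemma psi19_coef j : (j <= 9)%N -> psi19`_(9 - j) = (-1) ^+ j * esym19`_j.
Proof. by rewrite coef_Poly; do 10?[case: j => [|j] //]. Qed.

Lemma psi19_monic (K : fieldType) : map_poly intr psi19 \is @monic K.
Proof. by apply: monic_map; rewrite monicE /lead_coef (@PolyK _ 0). Qed.

Lemma size_psi19 (K : fieldType) : size (map_poly intr psi19 : {poly K}) = 10%N.
Proof.
rewrite size_map_poly_id0 ?(@PolyK _ 0) //.
by rewrite /lead_coef (@PolyK _ 0) //= oner_neq0.
Qed.

Lemma horner_psi19 (K : fieldType) (x : K) : x != 0 ->
  (map_poly intr psi19).[x + x^-1] * x ^+ 9 = \sum_(i < 19) x ^+ i.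
Proof.
move=> x0; rewrite horner_coef size_psi19.
rewrite !big_ord_recl !big_ord0 /= !coef_map /= !coef_Poly /= /bump /=.
by field.
Qed.

Lemma mesym_scale (R : comNzRingType) n k (s : R) (v : 'I_n -> R) :
  (mesym n R k).@[fun i => s * v i] = s ^+ k * (mesym n R k).@[v].
Proof.
rewrite !mesymE !rmorph_sum /= mulr_sumr; apply: eq_bigr => h /eqP hk.
rewrite !mevalX; under eq_bigr => i _ do rewrite exprMn.
rewrite big_split /= prodrXr; congr (s ^+ _ * _).
by rewrite -hk -mdeg_mesym1 mdegE.
Qed.

Lemma prod_XsubC_tuple (R : idomainType) n (v : 'I_n -> R) :
  \prod_i ('X - (v i)%:P) = \prod_(c <- [tuple v i | i < n]) ('X - c%:P).
Proof. by rewrite big_map -big_enum. Qed.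

Lemma coef_prod_XsubC (R : idomainType) n k (v : 'I_n -> R) : (k <= n)%N ->
  (\prod_i ('X - (v i)%:P))`_(n - k) = (-1) ^+ k * (mesym n R k).@[v].
Proof.
move=> kn; rewrite prod_XsubC_tuple.
have := mroots_coeff [tuple v i | i < n] (Ordinal (kn : k < n.+1)%N).
by move=> /= ->; congr (_ * _); apply: meval_eq => i; rewrite tnth_mktuple.
Qed.

(** By Vieta, both sides are up to sign a coefficient of the same product of linear factors. *)
Lemma mesym_reindex (R : idomainType) n k (s : 'I_n -> 'I_n) (v : 'I_n -> R) :
  injective s -> (k <= n)%N -> (mesym n R k).@[fun i => v (s i)] = (mesym n R k).@[v].
Proof.
move=> s_inj kn; apply: (can_inj (signrMK k)).
by rewrite -!coef_prod_XsubC // [in RHS](reindex_inj s_inj).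
Qed.

Lemma rmorph_mesym (R S : comNzRingType) (f : {rmorphism R -> S}) n k (v : 'I_n -> R) :
  f (mesym n R k).@[v] = (mesym n S k).@[f \o v].
Proof.
rewrite !mesymE (rmorph_sum (meval v)) (rmorph_sum (meval (f \o v))) rmorph_sum.
apply: eq_bigr => h _; rewrite /= !mevalX rmorph_prod.
by apply: eq_bigr => i _; rewrite rmorphXn.
Qed.

Lemma prod_XsubC_psi19 (K : fieldType) (v : 'I_9 -> K) :
  \prod_i ('X - (v i)%:P) = map_poly intr psi19 <->
  forall j, (j <= 9)%N -> (mesym 9 K j).@[v] = (esym19`_j)%:~R.
Proof.
have coef j : (j <= 9)%N -> (\prod_i ('X - (v i)%:P))`_(9 - j)
    = (-1) ^+ j * (mesym 9 K j).@[v] by move=> ?; rewrite coef_prod_XsubC.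
have sgn j : (-1) ^+ j * (-1) ^+ j = 1 :> K by rewrite -exprMn mulrNN mulr1 expr1n.
split=> [e j j9|e].
  rewrite -[LHS]mul1r -(sgn j) -mulrA -coef // e coef_map /= psi19_coef //.
  by rewrite intrM rmorphXn rmorphN1 mulrA sgn mul1r.
apply/polyP => i; have [i9|i9] := leqP i 9.
  rewrite -(subKn i9) coef ?leq_subr // e ?leq_subr // coef_map /= psi19_coef ?leq_subr //.
  by rewrite intrM rmorphXn rmorphN1.
rewrite !nth_default ?size_psi19 // prod_XsubC_tuple size_prod_XsubC size_tuple //.
Qed.

Lemma esym19_root (K : fieldType) (w : 'I_9 -> K) (x : K) : x != 0 ->
    w ord0 = x + x^-1 ->
    (forall j, (0 < j <= 9)%N -> (mesym 9 K j).@[w] = (esym19`_j)%:~R) ->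
  \sum_(i < 19) x ^+ i = 0.
Proof.
move=> x0 w0 ew; rewrite -horner_psi19 // -(prod_XsubC_psi19 w).2; last first.
  by move=> [|j] j9; [rewrite mesym0E rmorph1|apply: ew].
by rewrite (bigD1 ord0) //= hornerM hornerXsubC w0 subrr !mul0r.
Qed.

Lemma esym19_prim (K : fieldType) (x : K) j : 19.-primitive_root x -> (j <= 9)%N ->
  (mesym 9 K j).@[fun i => x ^+ (2 * i + 1) + x ^- (2 * i + 1)] = (esym19`_j)%:~R.
Proof.
move=> x_prim; move: j; set v := fun i => _; apply/prod_XsubC_psi19.
have x19 := prim_expr_order x_prim.
have x0 : x != 0 by apply/eqP => x0; move/eqP: x19; rewrite x0 expr0n eq_sym oner_eq0.
have rs : all (root (map_poly intr psi19)) [seq v i | i <- enum 'I_9].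
  apply/allP => _ /mapP[i _ ->]; rewrite /v.
  set t := x ^+ _; have t0 : t != 0 by rewrite expf_neq0.
  apply/rootP/(mulIf (expf_neq0 9 t0)); rewrite mul0r horner_psi19 //.
  have t1 : t - 1 != 0.
    rewrite subr_eq0 -(prim_order_dvd x_prim).
    by case: i @t t0 => [[|[|[|[|[|[|[|[|[|//]]]]]]]]]].
  by apply: (mulfI t1); rewrite mulr0 -subrX1 exprAC x19 expr1n subrr.
have vinj : injective v.
  move=> a b; rewrite /v => e.
  (* p + 1/p = q + 1/q forces p = q or p q = 1; among the odd exponents 1, ..., 17 modulo 19 this
     happens only when they are equal. *)
  have : (x ^+ (2 * a + 1) - x ^+ (2 * b + 1)) * (x ^+ (2 * a + 1 + (2 * b + 1)) - 1) = 0.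
    rewrite (exprD _ (2 * a + 1)).
    move: (x ^+ (2 * a + 1)) (x ^+ (2 * b + 1)) (expf_neq0 (2 * a + 1) x0)
      (expf_neq0 (2 * b + 1) x0) e => p q p0 q0 e.
    rewrite (_ : (p - q) * (p * q - 1) = p * q * (p + p^-1 - (q + q^-1))).
      by rewrite e subrr mulr0.
    by field; apply/andP.
  move=> /eqP; rewrite mulf_eq0 !subr_eq0 (eq_prim_root_expr x_prim) -(prim_order_dvd x_prim).
  move=> h; apply/val_inj/eqP; move: h; apply/implyP => {e}.
  have /allP chk : all (fun a => all (fun b =>
      ((2 * a + 1 == 2 * b + 1 %[mod 19]) || (19 %| 2 * a + 1 + (2 * b + 1)))%N
      ==> (a == b)) (iota 0 9)) (iota 0 9) by vm_compute.
  have ma (c : 'I_9) : val c \in iota 0 9 by rewrite mem_iota /= ltn_ord.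
  exact: (allP (chk _ (ma a)) _ (ma b)).
rewrite (all_roots_prod_XsubC _ rs).
- by rewrite (monicP (psi19_monic K)) scale1r big_map -big_enum.
- by rewrite size_map size_enum_ord size_psi19.
by rewrite uniq_rootsE map_inj_uniq // enum_uniq.
Qed.

(** * Conjugates of [alpha] *)

(* the representative of [+- m] modulo 38 between 0 and 19 *)
Definition fold38 (m : nat) : nat := (if m %% 38 < 19 then m %% 38 else 38 - m %% 38)%N.

Lemma coprime_odd38 (i : 'I_9) : coprime (2 * i + 1) 38.
Proof. by case: i => [[|[|[|[|[|[|[|[|[|//]]]]]]]]]]. Qed.

(** The Galois group permutes the nine pairs of complex conjugate primitive 38th roots of unity;
    this makes the sums S rational. *)
Lemma fold38_permute c : coprime c 38 ->
  exists2 s : 'I_9 -> 'I_9, injective s &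
    forall i : 'I_9, fold38 (c * (2 * i + 1)) = (2 * s i + 1)%N.
Proof.
move=> c38; pose t c i := (fold38 (c * (2 * i + 1))%N)./2.
have /allP chk : all (fun c => coprime c 38 ==> all (fun i =>
    [&& t c i < 9, fold38 (c * (2 * i + 1)) == 2 * t c i + 1 &
        all (fun j => (t c i == t c j) ==> (i == j)) (iota 0 9)]) (iota 0 9))%N
    (iota 0 38) by vm_compute.
have fc m : fold38 ((c %% 38)%N * m) = fold38 (c * m) by rewrite /fold38 modnMml.
have tc i : t (c %% 38)%N i = t c i by rewrite /t fc.
have c_in : (c %% 38)%N \in iota 0 38 by rewrite mem_iota ltn_mod.
have /allP chk_t := implyP (chk _ c_in) (etrans (coprime_modl _ _) c38).
have mi (i : 'I_9) : val i \in iota 0 9 by rewrite mem_iota /= ltn_ord.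
have t9 (i : 'I_9) : (t c i < 9)%N by rewrite -tc; case/and3P: (chk_t _ (mi i)).
exists (fun i => Ordinal (t9 i)) => [i j /(congr1 val) /= e|i].
  apply/val_inj/eqP; case/and3P: (chk_t _ (mi i)) => _ _ /allP/(_ _ (mi j))/implyP.
  by apply; rewrite !tc e.
by case/and3P: (chk_t _ (mi i)) => _ /eqP; rewrite fc tc.
Qed.

Lemma prod_alpha_exps (R : comNzRingType) (G : nat * nat * nat -> R) :
  \prod_(t <- alpha_exps) G t =
    G (1, 18, 1)%N * G (13, 6, 3)%N * G (4, 15, 5)%N * G (11, 8, 7)%N * G (17, 2, 9)%N
    * G (7, 12, 11)%N * G (3, 16, 13)%N * G (14, 5, 15)%N * G (9, 10, 17)%N.
Proof. by rewrite !big_cons big_nil mulr1 !mulrA. Qed.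

Section AlphaConjugates.
Variable F : fieldType.

Lemma rmorph_pi19 (E : comNzRingType) (f : {rmorphism F -> E}) y c :
  f (pi19 y c) = pi19 (f y) c.
Proof. by rewrite /pi19 rmorphD rmorphB rmorphN1 !rmorphXn. Qed.

Lemma rmorph_alpha19 (E : fieldType) (f : {rmorphism F -> E}) y :
  f (alpha19 y) = alpha19 (f y).
Proof.
rewrite /alpha19 rmorph_prod; apply: eq_bigr => t _.
by rewrite rmorphXn fmorph_div !rmorph_pi19.
Qed.

Lemma pi19_exp (x : F) m c : pi19 ((x ^+ m) ^+ 2) c = pi19 (x ^+ 2) (m * c).
Proof. by rewrite /pi19 (exprAC x m 2) -!(exprM (x ^+ 2)) ![(m * (_ * c))%N]mulnCA. Qed.

(** The exponent 37 is complex conjugation, which swaps numerator and denominator in each factor of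
    alpha. *)
Lemma alpha19V (x : F) : 38.-primitive_root x ->
  alpha19 ((x ^+ 37) ^+ 2) = (alpha19 (x ^+ 2))^-1.
Proof.
move=> x_prim; have x_sum := root38_sum x_prim.
have piN c : pi19 ((x ^+ 37) ^+ 2) c = pi19 (x ^+ 2) ((37 * c) %% 19).
  by rewrite (pi19_modn x_sum) pi19_exp.
rewrite /alpha19 -prodfV big_seq [RHS]big_seq; apply: eq_bigr => t t_in.
rewrite -exprVn invf_div !piN.
have /andP[/eqP -> /eqP ->] : ((37 * t.1.1) %% 19 == t.1.2)%N && ((37 * t.1.2) %% 19 == t.1.1)%N.
  by move: t t_in; apply/allP.
by [].
Qed.

(* [alpha1 k] with [zeta ^+ m] in place of [zeta] *)
Definition alpha_conj (x : F) (k m : nat) : F :=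
  alpha19 ((x ^+ m) ^+ 2) ^+ (38 ^ k) + (alpha19 ((x ^+ m) ^+ 2)) ^- (38 ^ k).

Lemma alpha_conj_fold (x : F) k m : 38.-primitive_root x -> coprime m 38 ->
  alpha_conj x k m = alpha_conj x k (fold38 m).
Proof.
move=> x_prim m38; have x38 := prim_expr_order x_prim.
have mod_m : alpha_conj x k m = alpha_conj x k (m %% 38).
  by rewrite /alpha_conj (expr_mod _ x38).
rewrite /fold38 mod_m; case: ifP => // _.
have c38 : coprime (m %% 38) 38 by rewrite coprime_modl.
have xm : 38.-primitive_root (x ^+ (m %% 38)) by rewrite prim_root_exp_coprime.
have e : x ^+ (38 - m %% 38) = (x ^+ (m %% 38)) ^+ 37.
  apply: (mulIf (_ : x ^+ (m %% 38) != 0)).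
    apply/eqP => x0; have /eqP := prim_expr_order xm.
    by rewrite x0 expr0n /= eq_sym oner_eq0.
  by rewrite -exprD subnK ?(ltnW (ltn_pmod _ _)) // x38 -exprSr (prim_expr_order xm).
rewrite /alpha_conj e alpha19V //.
by rewrite exprVn invrK addrC.
Qed.

End AlphaConjugates.

Section Conjugates.
Variables (L : splittingFieldType rat) (iota : {rmorphism L -> algC}) (zeta : L).
Hypothesis HL : is_Qzeta38 iota zeta.
Variables (sigma : int -> gal_of {:L}) (bar : L -> L).
Hypothesis Hsigma : is_sigma zeta sigma.
Hypothesis Hbar : is_conjugation iota bar.

Let z_prim : 38.-primitive_root zeta := zeta_prim HL.1.

Lemma rat_of_gal_fixed (x : L) :
  (forall s : gal_of {:L}, s x = x) -> exists q : rat, x = q%:A.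
Proof.
move=> fix_x; have galL : galois 1 {:L}.
  rewrite /galois sub1v normalFieldf andbT; apply/separableP => y _.
  apply: pcharf0_separable => p; apply/negbTE/negP => /andP[p_prime].
  rewrite -(fmorph_eq0 iota) rmorph_nat pnatr_eq0 => /eqP p0.
  by rewrite p0 in p_prime.
have : x \in fixedField 'Gal({:L} / 1)%g by apply/fixedFieldP; rewrite ?memvf.
by rewrite (galois_fixedField galL) => /vlineP[q ->]; exists q.
Qed.

Lemma iota_bar_zeta : iota (bar zeta) = iota (zeta ^+ 37).
Proof.
have n1 : `|zeta38C| = 1.
  apply/eqP; rewrite -(@pexpr_eq1 _ _ 38) ?normr_ge0 // -normrX.
  by rewrite (prim_expr_order zeta38C_prim) normr1.
rewrite Hbar rmorphXn HL.1; apply: (mulfI (_ : zeta38C != 0)).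
  by rewrite -normr_eq0 n1 oner_neq0.
by rewrite -normCK n1 expr1n -exprS (prim_expr_order zeta38C_prim).
Qed.

(** [bar] is known only through [iota], so expressions in zeta are conjugated in [algC], where [g]
    is the counterpart of [f]. *)
Lemma bar_morph (f : L -> L) (g : algC -> algC) :
    (forall x, iota (f x) = g (iota x)) -> (forall x, (g x)^* = g x^*) ->
  bar (f zeta) = f (zeta ^+ 37).
Proof.
move=> fg gC; apply: (fmorph_inj iota).
by rewrite Hbar fg gC -Hbar iota_bar_zeta fg.
Qed.

Lemma bar_pi19 : bar (pi229 zeta) = pi19 ((zeta ^+ 37) ^+ 2) 1.
Proof.
rewrite -[pi229 zeta]/(pi19 (zeta ^+ 2) 1).
apply: (bar_morph (f := fun x => pi19 (x ^+ 2) 1) (g := fun x => pi19 (x ^+ 2) 1)) => x.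
  by rewrite rmorph_pi19 rmorphXn.
by rewrite rmorph_pi19 rmorphXn.
Qed.

Lemma bar_alpha19 : bar (alpha19 (zeta ^+ 2)) = (alpha19 (zeta ^+ 2))^-1.
Proof.
rewrite -alpha19V //.
apply: (bar_morph (f := fun x => alpha19 (x ^+ 2)) (g := fun x => alpha19 (x ^+ 2))) => x.
  by rewrite rmorph_alpha19 rmorphXn.
by rewrite rmorph_alpha19 rmorphXn.
Qed.

Lemma ZGpowD (b : L) t1 t2 : b != 0 -> ZGpow b (t1 + t2) = ZGpow b t1 * ZGpow b t2.
Proof.
move=> b0; rewrite /ZGpow -big_split; apply: eq_bigr => s _ /=.
by rewrite ffunE expfzDr // fmorph_eq0.
Qed.

Lemma ZGpowMn (b : L) t k : b != 0 -> ZGpow b (t *+ k) = ZGpow b t ^+ k.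
Proof.
move=> b0; elim: k => [|k IH]; last by rewrite mulrSr exprSr ZGpowD // IH.
by rewrite mulr0n expr0 /ZGpow big1 // => s _; rewrite ffunE expr0z.
Qed.

Lemma ZGpow_ofG (b : L) s : ZGpow b (ofG s) = s b.
Proof.
have sG : s \in 'Gal({:L} / 1)%g.
  rewrite gal_kHom ?sub1v //; apply/kHom_monoid_morphism.
  by split; [exact: rmorph1|exact: rmorphM].
rewrite /ZGpow (bigD1 s) //= ffunE eqxx expr1z big1 ?mulr1 // => t /andP[_ ts].
by rewrite ffunE (negPf ts) expr0z.
Qed.

Lemma sigma_pi (c : int) (m i j : nat) : coprimez c 38 -> zeta ^ c = zeta ^+ m ->
    m = i %[mod 19] -> (37 * m)%N = j %[mod 19] ->
  sigma c (pi229 zeta / bar (pi229 zeta)) = pi19 (zeta ^+ 2) i / pi19 (zeta ^+ 2) j.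
Proof.
move=> c38 cm mi mj; rewrite bar_pi19 -[pi229 zeta]/(pi19 (zeta ^+ 2) 1).
have z_sum := root38_sum z_prim.
rewrite fmorph_div !rmorph_pi19 !rmorphXn /= (Hsigma c38) cm.
rewrite -(pi19_modn z_sum i) -(pi19_modn z_sum j) -mi -mj !(pi19_modn z_sum).
by rewrite pi19_exp muln1 -(exprM zeta) pi19_exp muln1 (mulnC m).
Qed.

Lemma alphaE : alpha zeta sigma bar = alpha19 (zeta ^+ 2).
Proof.
have z_sum := root38_sum z_prim; have nz := nz229_L iota.
have b0 : pi229 zeta / bar (pi229 zeta) != 0.
  have -> : bar (pi229 zeta) = pi19 (zeta ^+ 2) 18.
    by rewrite bar_pi19 pi19_exp -(pi19_modn z_sum (37 * 1)).
  rewrite -[pi229 zeta]/(pi19 (zeta ^+ 2) 1).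
  by rewrite mulf_neq0 ?invr_eq0 // (pi19_neq0 z_sum nz).
have zN (k m : nat) : (k + m = 38)%N -> zeta ^- k = zeta ^+ m.
  move=> km; have z38 := prim_expr_order z_prim.
  have zk0 : zeta ^+ k != 0.
    apply/eqP => zk; move/eqP: z38; rewrite -km exprD zk mul0r eq_sym.
    by rewrite oner_eq0.
  by apply: (mulfI zk0); rewrite mulfV // -exprD km.
have step t s k : ZGpow (pi229 zeta / bar (pi229 zeta)) (t + ofG s *+ k)
    = ZGpow (pi229 zeta / bar (pi229 zeta)) t * s (pi229 zeta / bar (pi229 zeta)) ^+ k.
  by rewrite ZGpowD // ZGpowMn // ZGpow_ofG.
rewrite /alpha /tau 8!step ZGpow_ofG.
rewrite (@sigma_pi 1 1 1 18) // (@sigma_pi 13 13 13 6) //.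
(* -15 is 23 modulo 38, hence 4 modulo 19; likewise -5 below is 33, hence 14. *)
rewrite (@sigma_pi (- 15) 23 4 15) //; last exact: zN.
rewrite (@sigma_pi 11 11 11 8) // (@sigma_pi 17 17 17 2) // (@sigma_pi 7 7 7 12) //.
rewrite (@sigma_pi 3 3 3 16) // (@sigma_pi (- 5) 33 14 5) //; last exact: zN.
rewrite (@sigma_pi 9 9 9 10) //.
by rewrite /alpha19 prod_alpha_exps /= expr1.
Qed.

Lemma SkE k j :
  Sk zeta sigma bar k j = (mesym 9 L j).@[fun i => alpha_conj zeta k (2 * i + 1)].
Proof.
apply: meval_eq => i; rewrite /alphaconj /alpha1 alphaE bar_alpha19 /alpha_conj.
rewrite rmorphD !rmorphXn fmorphV !rmorph_alpha19 !rmorphXn /= exprVn.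
by rewrite (@Hsigma (2 * i + 1)%:Z (coprime_odd38 i)).
Qed.

Lemma Sk_rat k j : (j <= 9)%N -> exists q : rat, Sk zeta sigma bar k j = q%:A.
Proof.
move=> j9; apply: rat_of_gal_fixed => s; rewrite SkE rmorph_mesym.
have : 38.-primitive_root (s zeta) by rewrite fmorph_primitive_root.
have [c cE] : exists c : nat, s zeta = zeta ^+ c.
  have [|c ->] := prim_rootP z_prim (_ : s zeta ^+ 38 = 1); last by exists c.
  by rewrite -rmorphXn (prim_expr_order z_prim) rmorph1.
rewrite cE prim_root_exp_coprime // => c38.
have [p p_inj pE] := fold38_permute c38.
rewrite -(mesym_reindex (fun i : 'I_9 => alpha_conj zeta k (2 * i + 1)) p_inj j9).
apply: meval_eq => i /=; rewrite -pE -alpha_conj_fold ?coprimeMl ?c38 ?coprime_odd38 //.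
rewrite /alpha_conj rmorphD fmorphV !rmorphXn !rmorph_alpha19 !rmorphXn /= cE.
by rewrite -!exprM -!mulnA.
Qed.

End Conjugates.

(** Supplies the stand-in for the residue field of a prime above [l], as a splitting field of X^N -
    1. *)
Lemma exists_prim_root (l N : nat) : prime l -> ~~ (l %| N)%N ->
  exists (K : fieldType) (w : K), l \in [pchar K] /\ N.-primitive_root w.
Proof.
move=> l_prime lN; have N0 : (0 < N)%N by case: N lN; rewrite ?dvdn0.
have pN0 : ('X^N - 1 : {poly 'F_l}) != 0 by rewrite monic_neq0 // monicXnsubC.
have [E [rs rsE _]] := FinSplittingFieldFor pN0.
have lE : l \in [pchar E] by rewrite (pchar_lalg E) pchar_Fp.
exists E; move: rsE; rewrite rmorphB rmorph1 /= map_polyXn => rsE.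
have XE : 'X^N - 1 = \prod_(x <- rs) ('X - x%:P).
  by apply/eqP; rewrite -eqp_monic // ?monic_prod_XsubC ?monicXnsubC.
have rs_uniq : uniq rs.
  rewrite -separable_prod_XsubC -XE separable_Xn_sub_1 //.
  by rewrite -(dvdn_pcharf lE).
have /hasP[w _ w_prim] : has N.-primitive_root rs.
  apply: cyclic.has_prim_root => //.
    by apply/allP => x; rewrite unity_rootE -subr_eq0 -root_prod_XsubC -XE /root !hornerE.
  have := congr1 (fun p : {poly E} => size p) XE.
  by rewrite size_XnsubC // size_prod_XsubC => -[->].
by exists w.
Qed.

Section SpecializeSk.
Variables (L : splittingFieldType rat) (iota : {rmorphism L -> algC}) (zeta : L).
Hypothesis HL : is_Qzeta38 iota zeta.
Variables (sigma : int -> gal_of {:L}) (bar : L -> L).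
Hypothesis Hsigma : is_sigma zeta sigma.
Hypothesis Hbar : is_conjugation iota bar.
Variables (K : fieldType) (z : K).
Hypothesis z_prim : 38.-primitive_root z.
Hypothesis nz229 : 229%:R != 0 :> K.

Lemma specializes_alpha_conj k m : coprime m 38 ->
  specializes zeta z (alpha_conj zeta k m) (alpha_conj z k m).
Proof.
move=> m38; have m37 : coprime (m * 37) 38 by rewrite coprimeMl m38.
have zeta_m : 38.-primitive_root (zeta ^+ m).
  by rewrite prim_root_exp_coprime // (zeta_prim HL.1).
have z_m : 38.-primitive_root (z ^+ m) by rewrite prim_root_exp_coprime.
rewrite /alpha_conj; apply: specializesD.
  by apply/specializesX/(specializes_alpha19 HL.1).
(* The inverse of alpha is its conjugate at exponent 37, which specializes as alpha itself does. *)
rewrite -!exprVn -(alpha19V zeta_m) -(alpha19V z_m) -!(exprM _ m 37).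
by apply/specializesX/(specializes_alpha19 HL.1).
Qed.

Lemma specializes_Sk k j :
  specializes zeta z (Sk zeta sigma bar k j)
    (mesym 9 K j).@[fun i => alpha_conj z k (2 * i + 1)].
Proof.
rewrite (SkE HL Hsigma Hbar); apply: specializes_mesym => i.
exact/specializes_alpha_conj/coprime_odd38.
Qed.

End SpecializeSk.

Lemma prime_primitive_root (K : fieldType) (p : nat) (x : K) :
  prime p -> x ^+ p = 1 -> x != 1 -> p.-primitive_root x.
Proof.
move=> p_prime xp x1; have [m m_prim] := prim_order_exists (prime_gt0 p_prime) xp.
move/(primeP p_prime).2 => /orP[] /eqP m_eq; last by rewrite -m_eq.
by move: (prim_expr_order m_prim) x1; rewrite m_eq expr1 => ->; rewrite eqxx.
Qed.

(** * The primality criterion *)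

(* Both residue lists together are the values of [38 ^ 2 ^ n + 1] modulo 229
   for [n > 1];
   the first list consists of the squares. *)
Definition square_residues : seq int := [:: - 48; - 44; 15; - 4; 56; - 55; - 45; - 61; 26; 49].
Definition nonsquare_residues : seq int := [:: - 98; 38; 92; - 69; 112; - 35; - 77; - 32].

Definition is_residue (s : seq int) (c : nat) : bool :=
  has (fun a => (c%:Z == a %% 229)%Z) s.

Lemma congr_one_ofP (M : nat) s :
  congr_one_of M 229 s <-> is_residue s (M %% 229).
Proof.
have ME : (M%:Z %% 229)%Z = (M %% 229)%N%:Z by rewrite modz_nat.
split=> [[a a_s e]|/hasP[a a_s /eqP e]]; last by exists a; rewrite // ME e.
by apply/hasP; exists a => //; rewrite -ME e.
Qed.

Lemma dlog_mod229 (n : nat) : (1 < n)%N -> let M := (38 ^ (2 ^ n) + 1)%N in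
  let d := dlog (M %% 229) in
  [/\ ~~ (229 %| M)%N, ~~ (19 %| d)%N &
      if odd d then congr_one_of M 229 nonsquare_residues
      else congr_one_of M 229 square_residues].
Proof.
pose next c := (c ^ 2 %% 229)%N.
have nextE k : (38 ^ 2 ^ k.+1 %% 229 = next (38 ^ 2 ^ k %% 229))%N.
  by rewrite /next expnSr expnM modnXm.
(* 38^4 has order dividing 57 = 228 / 4, and 2 has order 18 modulo 57, so from n = 2 on squaring
   runs through a cycle of at most 18 residues. *)
pose S := traject next (next (38 ^ 2 %% 229)%N) 18.
pose good c := [&& c != 0, ~~ (19 %| dlog c) & if odd (dlog c)
  then is_residue nonsquare_residues c else is_residue square_residues c]%N.
have /allP chk : all (fun x => good ((x + 1) %% 229)%N) S by vm_compute.
have /allP S_next : all (fun x => next x \in S) S by vm_compute.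
move=> n1 M d.
have x_S : (38 ^ 2 ^ n %% 229)%N \in S.
  rewrite -(subnK n1) addn2; elim: (n - 2)%N => [|k IH].
    by rewrite nextE mem_head.
  by rewrite nextE; apply: S_next.
have : good (M %% 229)%N by rewrite /M -modnDml; apply: chk.
case/and3P=> M0 d19 cl; split=> //; rewrite -/d.
by move: cl; rewrite -/d; case: ifP => _ /congr_one_ofP.
Qed.

(** [s] = 1 gives the values of (i) and [s] = -1 those of (ii), as e_j is homogeneous of degree
    j. *)
Definition final_values (L : splittingFieldType rat) (M : nat) (T : nat -> L) (s : int) : Prop :=
  forall j, (0 < j <= 9)%N -> congr_in M (T j) (s ^+ j * esym19`_j).

Lemma prime_final_values
  (L : splittingFieldType rat) (iota : {rmorphism L -> algC}) (zeta : L)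
  (HL : is_Qzeta38 iota zeta)
  (sigma : int -> gal_of {:L}) (Hsigma : is_sigma zeta sigma)
  (bar : L -> L) (Hbar : is_conjugation iota bar) (r M : nat) :
    (3 < r)%N -> M = (38 ^ r).+1 -> prime M -> ~~ (229 %| M)%N ->
    ~~ (19 %| dlog (M %% 229))%N ->
  final_values M (Sk zeta sigma bar r.-1) ((- 1) ^+ dlog (M %% 229)).
Proof.
move=> r3 eM M_prime M229; set d := dlog _ => d19 j /andP[j0 j9].
have M_gt : (38 * 229 < M)%N.
  have : (38 * 38 ^ 2 <= 38 ^ r)%N by rewrite -expnS leq_exp2l // ltnW.
  by rewrite eM ltnS; apply: leq_trans; rewrite leq_pmul2l.
have [K [w [MK w_prim]]] : exists (K : fieldType) (w : K),
    M \in [pchar K] /\ (38 * 229).-primitive_root w.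
  by apply: exists_prim_root => //; rewrite gtnNdvd.
have z_prim : 38.-primitive_root (w ^+ 229).
  by have := dvdn_prim_root w_prim (dvdn_mulr 229 (dvdnn 38)); rewrite mulKn.
have u_prim : 229.-primitive_root (w ^+ 38).
  by have := dvdn_prim_root w_prim (dvdn_mull 38 (dvdnn 229)); rewrite mulnK.
set z := w ^+ 229 in z_prim; set u := w ^+ 38 in u_prim.
have nz229 : 229%:R != 0 :> K.
  rewrite -(dvdn_pcharf MK) gtnNdvd //.
  exact: leq_ltn_trans (leq_pmull 229 (isT : (0 < 38)%N)) M_gt.
have u1 : u != 1 by rewrite -[u]expr1 -(prim_order_dvd u_prim).
have z0 : z != 0 := prim_root_neq0 z_prim.
have resid m : coprime m 38 ->
    alpha19 ((z ^+ m) ^+ 2) ^+ (38 ^ r.-1) = (z ^- d) ^+ m.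
  move=> m38; have zm : 38.-primitive_root (z ^+ m) by rewrite prim_root_exp_coprime.
  have := alpha19_residue (root38_sum zm) zm nz229 (prim_expr_order u_prim) u1
    (ltnW (ltnW r3)) eM MK M229.
  rewrite -/d => e; have zmd0 : (z ^+ m) ^+ d != 0 by do 2!apply: expf_neq0.
  have -> : alpha19 ((z ^+ m) ^+ 2) ^+ (38 ^ r.-1) = ((z ^+ m) ^+ d)^-1.
    by apply: (mulfI zmd0); rewrite e mulfV.
  by rewrite exprVn exprAC.
(* The symbol z^-d is s x with x^19 = 1, and x is primitive because 19 does not divide d. *)
pose s : K := (-1) ^+ d; pose x := s * z ^- d.
have s2 : s * s = 1 by rewrite -expr2 sqrr_sign.
have s_odd k : s ^+ (2 * k + 1) = s by rewrite exprD exprM expr2 s2 expr1n mul1r expr1.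
have s0 : s != 0 by rewrite signr_eq0.
have sV : s^-1 = s by apply: (mulfI s0); rewrite mulfV.
have x_prim : 19.-primitive_root x.
  apply: prime_primitive_root => //.
    rewrite exprMn exprVn (exprAC z) (root38_sqrt z_prim) -/s sV.
    by rewrite -[19%N]/(2 * 9 + 1)%N s_odd s2.
  apply/eqP => x1; have zd : z ^+ d = s.
    by rewrite -[LHS]mul1r -x1 /x mulfVK // expf_neq0.
  have : z ^+ (2 * d) = 1 by rewrite mulnC exprM zd expr2.
  by move/eqP; rewrite -(prim_order_dvd z_prim) (@dvdn_pmul2l 2 19) // (negPf d19).
have [q Tq] := Sk_rat HL Hsigma Hbar r.-1 j9.
exists q => //; apply: (specializes_congr_rat HL.1 z_prim nz229 M_prime MK).
rewrite -Tq; have := specializes_Sk HL Hsigma Hbar z_prim nz229 r.-1 j.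
rewrite intrM !rmorphXn rmorphN1 -/s -(esym19_prim x_prim j9) -mesym_scale.
rewrite (@meval_eq _ _ _ (fun i : 'I_9 => s * (x ^+ (2 * i + 1) + x ^- (2 * i + 1)))) // => i.
rewrite /alpha_conj (resid _ (coprime_odd38 i)) /x.
move: (z ^- d) => t.
by rewrite exprMn s_odd invfM sV mulrDr !mulrA s2 !mul1r.
Qed.

(** The values make s A a 19th root of unity other than 1, where A = a^(38^(r-1)), so a^(2^r) has
    order exactly 19^r. On the other hand a is a rational expression in z, so it is fixed by the
    18th power of Frobenius and its order divides l^18 - 1. *)
Lemma esym19_divides (K : fieldType) (z : K) (l r : nat) (s : int) :
    prime l -> l \in [pchar K] -> 38.-primitive_root z -> 229%:R != 0 :> K ->
    (0 < r)%N -> s * s = 1 ->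
    (forall j, (0 < j <= 9)%N ->
      (mesym 9 K j).@[fun i => alpha_conj z r.-1 (2 * i + 1)] = (s ^+ j * esym19`_j)%:~R) ->
  l ^ 18 = 1 %[mod 19 ^ r].
Proof.
move=> l_prime lK z_prim nz229 r0 s2 ej.
have z_sum := root38_sum z_prim; have z38 := prim_expr_order z_prim.
have l38 : ~~ (l %| 38)%N.
  by apply/negP => l38; rewrite (prim_root_pcharF z_prim l38) in lK.
pose a := alpha19 (z ^+ 2); pose A := a ^+ (38 ^ r.-1).
have a0 : a != 0 := alpha19_neq0 z_sum nz229.
pose sK : K := s%:~R; have sK2 : sK * sK = 1 by rewrite -intrM s2.
have sK0 : sK != 0 by apply/eqP => e; move/eqP: sK2; rewrite e mul0r eq_sym oner_eq0.
have sKV : sK^-1 = sK by apply: (mulfI sK0); rewrite mulfV.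
have x_sum : \sum_(i < 19) (sK * A) ^+ i = 0.
  apply: (@esym19_root _ (fun i : 'I_9 => sK * alpha_conj z r.-1 (2 * i + 1))).
  - by rewrite mulf_neq0 ?expf_neq0.
  - by rewrite /= /alpha_conj muln0 add0n expr1 invfM sKV mulrDr.
  move=> j hj; rewrite mesym_scale ej // intrM rmorphXn /= mulrA -exprMn.
  by rewrite -/sK sK2 expr1n mul1r.
have A2E : (sK * A) ^+ 2 = A ^+ 2 by rewrite exprMn expr2 sK2 mul1r.
have x19 : (sK * A) ^+ 19 = 1 by apply: expr19.
have A2 : A ^+ 2 != 1.
  rewrite -A2E; apply/eqP => x2.
  have x1 : sK * A = 1.
    by move: x19; rewrite -[19%N]/(2 * 9 + 1)%N exprD exprM x2 expr1n mul1r expr1.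
  move: x_sum; rewrite x1; under eq_bigr do rewrite expr1n.
  rewrite sumr_const card_ord => /eqP; rewrite -(dvdn_pcharf lK) => l19.
  by rewrite (@dvdn_trans 19) in l38.
(* This power removes the 2-part of the order: b^(19^r) = A^38 and b^(19^(r-1)) = A^2. *)
pose b := a ^+ (2 ^ r).
have br : b ^+ (19 ^ r) = 1.
  have e38 : (2 ^ r * 19 ^ r = 38 ^ r.-1 * (2 * 19))%N.
    by rewrite -expnMn -expnSr prednK.
  by rewrite /b -exprM e38 !exprM -/A -A2E exprAC x19 expr1n.
have br1 : b ^+ (19 ^ r.-1) != 1.
  have e38 : (2 ^ r * 19 ^ r.-1 = 38 ^ r.-1 * 2)%N.
    by rewrite -{1}(prednK r0) expnS -mulnA -expnMn mulnC.
  by rewrite /b -exprM e38 exprM.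
have Fa k : a ^+ (l ^ k) = alpha19 ((z ^+ 2) ^+ (l ^ k)).
  elim: k => [|k IH]; first by rewrite expn0 !expr1.
  rewrite expnSr exprM IH -(pFrobenius_autE lK) rmorph_alpha19 /=.
  by rewrite pFrobenius_autE -(exprM (z ^+ 2)).
have al : a ^+ (l ^ 18) = a.
  have l1 : l ^ 18 = 1 %[mod 38].
    rewrite (_ : 18 = totient 38)%N //; apply: cyclic.Euler_exp_totient.
    by rewrite prime_coprime.
  by rewrite Fa exprAC -(expr_mod _ z38) l1 (expr_mod _ z38).
have b_prim : (19 ^ r).-primitive_root b.
  have r19 : (0 < 19 ^ r)%N by rewrite expn_gt0.
  have [m m_prim] := prim_order_exists r19 br.
  move/(dvdn_pfactor _ _ (isT : prime 19)) => [i i_r mE].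
  have [ir|ri] := leqP r i; last first.
    case/negP: br1; rewrite -(prim_order_dvd m_prim) mE dvdn_exp2l //.
    by rewrite -ltnS prednK.
  by have <- : m = (19 ^ r)%N by rewrite mE; congr (_ ^ _)%N; apply/anti_leq/andP.
apply/eqP; rewrite eqn_mod_dvd ?expn_gt0 ?prime_gt0 // (prim_order_dvd b_prim).
rewrite /b exprAC; apply/eqP.
have -> : a ^+ (l ^ 18 - 1) = 1; last by rewrite expr1n.
apply: (mulfI a0); rewrite mulr1 -exprS -[RHS]al subn1 prednK //.
by rewrite expn_gt0 prime_gt0.
Qed.

Lemma prime_of_final_values
  (L : splittingFieldType rat) (iota : {rmorphism L -> algC}) (zeta : L)
  (HL : is_Qzeta38 iota zeta)
  (sigma : int -> gal_of {:L}) (Hsigma : is_sigma zeta sigma)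
  (bar : L -> L) (Hbar : is_conjugation iota bar) (r M : nat) (s : int) :
    (0 < r)%N -> M = (38 ^ r).+1 -> ~~ (229 %| M)%N -> s * s = 1 ->
    (forall x : nat, (1 < x < 19 ^ r)%N -> x ^ 18 = 1 %[mod 19 ^ r] -> ~~ (x %| M)%N) ->
    final_values M (Sk zeta sigma bar r.-1) s ->
  prime M.
Proof.
move=> r0 eM M229 s2 Hx Tv; apply: ltn_pdiv2_prime; first by rewrite eM.
have M1 : (1 < M)%N by rewrite eM ltnS expn_gt0.
have l_prime := pdiv_prime M1; have lM := pdiv_dvd M.
have le : (19 ^ r <= pdiv M)%N.
  rewrite leqNgt; apply/negP => lt.
  suff l18 : pdiv M ^ 18 = 1 %[mod 19 ^ r].
    by have := Hx (pdiv M); rewrite prime_gt1 // lt lM => /(_ isT l18).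
  have l38 : ~~ (pdiv M %| 38)%N.
    apply/negP => l38; have := prime_gt1 l_prime; rewrite ltnNge; case/negP.
    have : (pdiv M %| 38 ^ r)%N by apply: dvdn_trans l38 _; apply: dvdn_exp.
    by move: lM; rewrite {2}eM -addn1 => lM lr; move: lM; rewrite dvdn_addr // dvdn1 => /eqP ->.
  have [K [z [lK z_prim]]] := exists_prim_root l_prime l38.
  have nz229 : 229%:R != 0 :> K.
    rewrite -(dvdn_pcharf lK) dvdn_prime2 //; apply: contra M229 => /eqP <-.
    exact: lM.
  apply: (esym19_divides l_prime lK z_prim nz229 r0 s2) => j hj.
  have [q Tq Cq] := Tv j hj.
  apply: (congr_rat_specializes HL.1 z_prim nz229 lK lM Cq).
  by rewrite -Tq; exact: (specializes_Sk HL Hsigma Hbar z_prim nz229).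
(* 38^r + 1 is at most 39^r, which is below 361^r = (19^r)^2. *)
apply: leq_trans (_ : (19 ^ r) ^ 2 <= _)%N; last by rewrite leq_exp2r.
have lt38 : (38 ^ r < 39 ^ r)%N by rewrite ltn_exp2r.
rewrite eM -expnM mulnC expnM; apply: leq_ltn_trans lt38 _.
by rewrite ltn_exp2r.
Qed.

Theorem proposition4p7
  (L : splittingFieldType rat) (iota : {rmorphism L -> algC}) (zeta : L)
  (HL : is_Qzeta38 iota zeta)
  (sigma : int -> gal_of {:L}) (Hsigma : is_sigma zeta sigma)
  (bar : L -> L) (Hbar : is_conjugation iota bar)
  (n r M : nat) (Hn : (1 < n)%N) (Hr : r = (2 ^ n)%N)
  (HM : M = (38 ^ (2 ^ n) + 1)%N)
  (Hx : forall x : nat, (1 < x < 19 ^ r)%N -> x ^ 18 = 1 %[mod 19 ^ r] ->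
        ~~ (x %| M)%N) :
  let T := Sk zeta sigma bar r.-1 in
  prime M <->
    (congr_one_of M 229
       [:: - 48; - 44; 15; - 4; 56; - 55; - 45; - 61; 26; 49]
     /\ congr_in M (T 1%N) (- 1) /\ congr_in M (T 2%N) (- 8)
     /\ congr_in M (T 3%N) 7 /\ congr_in M (T 4%N) 21
     /\ congr_in M (T 5%N) (- 15) /\ congr_in M (T 6%N) (- 20)
     /\ congr_in M (T 7%N) 10 /\ congr_in M (T 8%N) 5
     /\ congr_in M (T 9%N) (- 1))
    \/
    (congr_one_of M 229 [:: - 98; 38; 92; - 69; 112; - 35; - 77; - 32]
     /\ congr_in M (T 1%N) 1 /\ congr_in M (T 2%N) (- 8)
     /\ congr_in M (T 3%N) (- 7) /\ congr_in M (T 4%N) 21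
     /\ congr_in M (T 5%N) 15 /\ congr_in M (T 6%N) (- 20)
     /\ congr_in M (T 7%N) (- 10) /\ congr_in M (T 8%N) 5
     /\ congr_in M (T 9%N) 1).
Proof.
move=> T; have r3 : (3 < r)%N by rewrite Hr (leq_exp2l 2 n (isT : (1 < 2)%N)).
have eM : M = (38 ^ r).+1 by rewrite HM Hr addn1.
have [M229 d19 cl] := dlog_mod229 Hn; rewrite -HM in M229 d19 cl.
split=> [M_prime|].
  have Tv := prime_final_values HL Hsigma Hbar r3 eM M_prime M229 d19.
  move: cl Tv; rewrite -signr_odd; case: (odd _) => cl Tv; [right|left].
    by do 9?split=> //; apply: Tv.
  by do 9?split=> //; apply: Tv.
have r0 : (0 < r)%N := ltnW (ltnW (ltnW r3)).
case=> [] [_ [T1 [T2 [T3 [T4 [T5 [T6 [T7 [T8 T9]]]]]]]]].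
  apply: (prime_of_final_values HL Hsigma Hbar (s := 1) r0 eM M229) => //.
  by do 10?[case=> //].
apply: (prime_of_final_values HL Hsigma Hbar (s := -1) r0 eM M229) => //.
by do 10?[case=> //].
Qed.
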